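(* Let $k\ge1$ and $n\ge1$ be integers. \begin{enumerate} \item[(a)] A graph $G\in\mathcal{G}_{n,n+k}$ minimizes $d_2(\cdot)$ over $\mathcal{G}_{n,n+k}$ if and only if $G$ is a balanced weak subdivision of some $D\in\mathcal{D}_k$. (When $n\ge2k$, ``weak subdivision'' may be replaced by ``subdivision'', i.e. all chain lengths positive.) \item[(b)] If $G$ is an imbalanced weak subdivision of $D\in\mathcal{D}_k$, then choosing a pair of chains of $G$ relative to $D$ whose lengths differ by at least two and moving one edge from the longer to the shorter chain (i.e. decreasing the longer length by one and increasing the shorter by one) yields a graph with a strictly smaller value of $d_2(\cdot)$. \end{enumerate}
   Context: Graphs are finite connected multigraphs (multiple edges and loops allowed), considered up to isomorphism. $\mathcal{G}_{n,m}$ is the set of connected graphs with $n$ vertices and $m$ edges. $d_i(G)$ is the number of sets of $i$ edges of $G$ whose deletion disconnects $G$. $\mathcal{D}_k$ is the set of 3-edge-connected cubic graphs with $2k$ vertices and $3k$ edges (for $k=1$ this is the graph with two vertices joined by three edges). A weak subdivision of a cubic graph $D$ is a graph obtained by assigning to each edge $e$ of $D$ a nonnegative integer weight $\ell(e)$ such that every cycle of $D$ has positive total weight, contracting each edge of weight $0$, and replacing each edge of weight $\ell\ge1$ by a path with $\ell$ edges. Each edge of $D$ thus corresponds to a chain of $G$ relative to $D$ (possibly of length zero), whose length is the weight. $G$ is balanced with respect to $D$ if its chain lengths (including zeros) pairwise differ by at most one, and imbalanced otherwise. *)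

(* Defs.v *)
From mathcomp Require Import all_boot.

Set Implicit Arguments.
Unset Strict Implicit.
Unset Printing Implicit Defensive.

(* Finite multigraphs, loops and parallel edges allowed. The order of the two
   ends of an edge carries no meaning: [mg_iso] may swap them. *)
Record mgraph := MGraph {
  vert : finType;
  edge : finType;
  src : edge -> vert;
  tgt : edge -> vert
}.

Definition mg_iso (G H : mgraph) : Prop :=
  exists (fV : vert G -> vert H) (fE : edge G -> edge H),
    [/\ bijective fV, bijective fE
      & forall e : edge G,
          (src (fE e) = fV (src e) /\ tgt (fE e) = fV (tgt e)) \/
          (src (fE e) = fV (tgt e) /\ tgt (fE e) = fV (src e))].

(* Adjacency in G - F. *)
Definition adj_del (G : mgraph) (F : {set edge G}) : rel (vert G) :=
  fun x y => [exists e : edge G,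
    (e \notin F) && (((src e == x) && (tgt e == y)) ||
                     ((src e == y) && (tgt e == x)))].

Definition connected_del (G : mgraph) (F : {set edge G}) : bool :=
  (0 < #|vert G|) && [forall x, forall y, connect (adj_del F) x y].

Definition connected (G : mgraph) : bool := connected_del (set0 : {set edge G}).

(* Membership in G_{n,m}. *)
Definition in_Gnm (n m : nat) (G : mgraph) : bool :=
  [&& connected G, #|vert G| == n & #|edge G| == m].

(* d_i(G). *)
Definition ndisc (i : nat) (G : mgraph) : nat :=
  #|[set F : {set edge G} | (#|F| == i) && ~~ connected_del F]|.

Definition minimizes_ndisc (i n m : nat) (G : mgraph) : Prop :=
  in_Gnm n m G /\ forall H : mgraph, in_Gnm n m H -> ndisc i G <= ndisc i H.

(* A loop contributes 2. *)
Definition degree (G : mgraph) (x : vert G) : nat :=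
  #|[set e : edge G | src e == x]| + #|[set e : edge G | tgt e == x]|.

Definition cubic (G : mgraph) : bool := [forall x : vert G, degree x == 3].

Definition edge_connected (r : nat) (G : mgraph) : bool :=
  [forall F : {set edge G}, (#|F| < r) ==> connected_del F].

(* Membership in D_k. *)
Definition in_Dk (k : nat) (D : mgraph) : bool :=
  [&& edge_connected 3 D, cubic D, #|vert D| == 2 * k & #|edge D| == 3 * k].

(* Oriented edges: (e, false) runs from src e to tgt e, (e, true) backwards. *)
Definition dart (G : mgraph) : Type := (edge G * bool)%type.

Definition dtail (G : mgraph) (a : dart G) : vert G :=
  if a.2 then tgt a.1 else src a.1.

Definition dhead (G : mgraph) (a : dart G) : vert G :=
  if a.2 then src a.1 else tgt a.1.

(* Distinctness of the edges rules out running back and forth along a single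
   edge; a loop is a cycle of length 1, two parallel edges one of length 2. *)
Definition mg_cycle (G : mgraph) (c : seq (dart G)) : bool :=
  [&& 0 < size c,
      cycle (fun a b : dart G => dhead a == dtail b) c,
      uniq [seq dtail a | a <- c]
    & uniq [seq a.1 | a <- c]].

Definition admissible (D : mgraph) (l : edge D -> nat) : Prop :=
  forall c : seq (dart D), mg_cycle c -> 0 < \sum_(a <- c) l a.1.

(* Contraction of the edges in Z: a vertex is the vertex set of a connected
   component of the spanning subgraph with edge set Z. *)
Definition zclass (D : mgraph) (Z : {set edge D}) (x : vert D) :
    {set vert D} :=
  [set y | connect (adj_del (~: Z)) x y].

Definition contract_vert (D : mgraph) (Z : {set edge D}) : finType :=
  {A : {set vert D} | A \in [set zclass Z x | x : vert D]}.

Definition contract_proj (D : mgraph) (Z : {set edge D}) (x : vert D) :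
    contract_vert Z :=
  exist _ (zclass Z x) (imset_f (zclass Z) (isT : x \in vert D)).

Definition contract (D : mgraph) (Z : {set edge D}) : mgraph :=
  @MGraph (contract_vert Z) {e : edge D | e \notin Z}
    (fun e => contract_proj Z (src (val e)))
    (fun e => contract_proj Z (tgt (val e))).

(* For l e >= 1, the edge e is replaced by the path
     sub_pt e 0 = src e, sub_pt e 1, ..., sub_pt e (l e) = tgt e,
   whose (l e).-1 internal vertices are new, and whose edges (e, i), i < l e,
   join sub_pt e i to sub_pt e i.+1. Only used with all l e >= 1. *)
Definition sub_vert (G : mgraph) (l : edge G -> nat) : finType :=
  (vert G + {e : edge G & 'I_(l e).-1})%type.

Definition sub_pt (G : mgraph) (l : edge G -> nat) (e : edge G) (j : nat) :
    sub_vert l :=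
  if j is j'.+1 then
    if insub j' is Some i then inr (existT (fun e => 'I_(l e).-1) e i)
    else inl (tgt e)
  else inl (src e).

Definition subdivide (G : mgraph) (l : edge G -> nat) : mgraph :=
  @MGraph (sub_vert l) {e : edge G & 'I_(l e)}
    (fun p => sub_pt l (tag p) (tagged p))
    (fun p => sub_pt l (tag p) (tagged p).+1).

Definition weak_subdivide (D : mgraph) (l : edge D -> nat) : mgraph :=
  @subdivide (contract [set e | l e == 0]) (fun e => l (val e)).

(* G is the weak subdivision of D with chain lengths l. *)
Definition weak_subdivision (D : mgraph) (l : edge D -> nat) (G : mgraph) :
    Prop :=
  admissible l /\ mg_iso G (weak_subdivide l).

Definition balanced (D : mgraph) (l : edge D -> nat) : bool :=
  [forall e, forall f, l e <= (l f).+1].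

(* One edge is moved from chain e to chain f (e != f). *)
Definition move_edge (D : mgraph) (l : edge D -> nat) (e f : edge D) :
    edge D -> nat :=
  fun g => if g == e then (l g).-1 else if g == f then (l g).+1 else l g.

(* Main.v *)
Require Import Defs.
From mathcomp Require Import all_boot zify.

(* Subdividing a graph with e edges into chains of lengths l makes every pair of
   edges on one chain disconnecting, and nothing else when the graph is
   3-edge-connected; so d_2 is then the sum of the binomials C(l, 2), which
   settles moving an edge.
   Lower bound: a bridgeless graph is a subdivision of a graph of minimum degree
   3, hence of one with at most 3k edges; convexity in the form
   C(x, 2) >= q x - C(q + 1, 2), tight exactly for x in {q, q + 1}, gives
   d_2 >= q m - 3k C(q + 1, 2) for every q, and contracting a bridge costs m - 1
   disconnecting pairs. Equality for q = m / (3k) > 0 forces 3k balanced chains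
   on a 3-edge-connected cubic graph. For n <= 2k the minimum is 0, attained by
   the 3-edge-connected graphs; these are contractions of graphs in D_k because
   a vertex of degree at least 4 can be split, keeping 3-edge-connectivity, by
   moving two of its darts to a new neighbour. *)

Set Implicit Arguments.
Unset Strict Implicit.
Unset Printing Implicit Defensive.

(** * Edge cuts *)

(** [weak_subdivide] lives on quotient and dependent types, which resist induction on the vertices.
    The proof therefore works with [chain_model], a description of the chains inside G itself that
    is equivalent to an isomorphism with [weak_subdivide] and can be edited one vertex or one edge
    at a time. Connectivity is likewise read off from cuts. The slope q of the tangent is kept free
    because a balanced l takes only two consecutive values q and q + 1, and equality for that q,
    even q = 0, proves minimality for every n at once. The converse cannot use q = 0: there C(q + 1,
    2) vanishes and equality no longer forces 3k chains. This is why small n calls for vertex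
    splitting. *)

Definition joins (G : mgraph) (e : edge G) (x y : vert G) : bool :=
  ((src e == x) && (tgt e == y)) || ((src e == y) && (tgt e == x)).

Definition cut (G : mgraph) (S : {set vert G}) : {set edge G} :=
  [set e | (src e \in S) != (tgt e \in S)].

Lemma joins_src_tgt (G : mgraph) (e : edge G) : joins e (src e) (tgt e).
Proof. by rewrite /joins !eqxx. Qed.

Lemma joinsC (G : mgraph) (e : edge G) x y : joins e x y = joins e y x.
Proof. by rewrite /joins orbC. Qed.

Lemma adj_del_sym (G : mgraph) (F : {set edge G}) : connect_sym (adj_del F).
Proof. by apply: sym_connect_sym => x y; apply: eq_existsb => e; rewrite orbC. Qed.

Lemma adj_delP (G : mgraph) (F : {set edge G}) x y :
  reflect (exists2 e, e \notin F & joins e x y) (adj_del F x y).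
Proof.
by apply: (iffP existsP) => [[e /andP[]]|[e eF jxy]]; exists e => //; apply/andP.
Qed.

Lemma in_cut_joins (G : mgraph) (S : {set vert G}) e x y :
  joins e x y -> (e \in cut S) = ((x \in S) != (y \in S)).
Proof.
by rewrite inE => /orP[]/andP[/eqP-> /eqP->] //; rewrite eq_sym.
Qed.

Lemma cutC (G : mgraph) (S : {set vert G}) : cut (~: S) = cut S.
Proof. by apply/setP=> e; rewrite !inE; do 2 case: (_ \in S). Qed.

Lemma setC_eq0 (T : finType) (A : {set T}) : (~: A == set0) = (A == setT).
Proof. by rewrite -setCT (inj_eq (can_inj (@setCK T))). Qed.

Lemma setC_eqT (T : finType) (A : {set T}) : (~: A == setT) = (A == set0).
Proof. by rewrite -setC0 (inj_eq (can_inj (@setCK T))). Qed.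

Lemma card_set_sum (T : finType) (p : pred T) : #|[set x | p x]| = \sum_x p x.
Proof.
by rewrite -sum1_card big_mkcond; apply: eq_bigr => x _; rewrite inE; case: (p x).
Qed.

Lemma cut_submod (G : mgraph) (A B : {set vert G}) :
  #|cut (A :|: B)| + #|cut (A :&: B)| <= #|cut A| + #|cut B|.
Proof.
rewrite !card_set_sum -!big_split; apply: leq_sum => e _ /=; rewrite !inE.
by do 2 case: (_ \in A); do 2 case: (_ \in B).
Qed.

Lemma connect_cut (G : mgraph) (F : {set edge G}) (S : {set vert G}) x y :
  connect (adj_del F) x y -> cut S \subset F -> (x \in S) = (y \in S).
Proof.
move=> cxy sSF; apply: (closed_connect _ cxy) => a b /adj_delP[e eF jab].
apply/eqP; apply: contraNT eF => nab.
by apply: (subsetP sSF); rewrite (in_cut_joins _ jab).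
Qed.

(** If G - F is disconnected, the component S of a vertex is crossed by no remaining edge. This
    translates deletions into cuts. *)
Lemma connected_delPn (G : mgraph) (F : {set edge G}) : 0 < #|vert G| ->
  reflect (exists S, [/\ S != set0, S != setT & cut S \subset F])
          (~~ connected_del F).
Proof.
move=> V0; apply: (iffP idP) => [|[S [/set0Pn[x xS] ST sSF]]].
  rewrite /connected_del V0 /= => /forallPn[x /forallPn[y nxy]].
  exists [set z | connect (adj_del F) x z]; split.
  - by apply/set0Pn; exists x; rewrite inE connect0.
  - by apply: contraNneq nxy => /setP/(_ y); rewrite !inE.
  apply/subsetP=> e; rewrite !inE; apply: contraR => eF.
  have ae: adj_del F (src e) (tgt e).
    by apply/adj_delP; exists e => //; exact: joins_src_tgt.
  by rewrite (same_connect1r (adj_del_sym F) ae).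
apply: contra ST => /andP[_ /forallP/(_ x)/forallP cx].
by apply/eqP/setP=> y; rewrite inE -(connect_cut (cx y) sSF).
Qed.

(** The cut form of r-edge-connectivity for r > 0. A one-vertex graph satisfies it for every r,
    which lets a bouquet of loops start the induction in [exists_cuts_geq3]. *)
Definition cuts_geq (r : nat) (G : mgraph) : Prop :=
  0 < #|vert G| /\
  forall S : {set vert G}, S != set0 -> S != setT -> r <= #|cut S|.

Lemma edge_connectedP (r : nat) (G : mgraph) : 0 < r ->
  reflect (cuts_geq r G) (edge_connected r G).
Proof.
move=> r0; apply: (iffP forallP) => [ec|[V0 cg] F].
  have V0: 0 < #|vert G|.
    by have := ec set0; rewrite cards0 r0 /= => /andP[].
  split=> // S S0 ST; rewrite leqNgt; apply/negP=> lt.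
  have := ec (cut S); rewrite lt /=; apply/negP; apply/connected_delPn => //.
  by exists S.
apply/implyP=> lt; apply: contraLR lt => /(connected_delPn _ V0)[S [S0 ST sSF]].
by rewrite -leqNgt (leq_trans (cg S S0 ST)) ?subset_leq_card.
Qed.

Lemma connected_cuts (G : mgraph) : connected G <-> cuts_geq 1 G.
Proof.
split=> [cG|[V0 cg]].
  have V0: 0 < #|vert G| by case/andP: cG.
  split=> // S S0 ST; rewrite card_gt0; apply: contraTN cG => /eqP c0.
  by apply/connected_delPn => //; exists S; rewrite c0 sub0set.
rewrite /connected -[connected_del _]negbK; apply/(connected_delPn _ V0) => -[S [S0 ST]].
by rewrite subset0 -cards_eq0 => /eqP c0; have := cg S S0 ST; rewrite c0.
Qed.

Lemma cuts_geqW (r s : nat) (G : mgraph) : r <= s -> cuts_geq s G -> cuts_geq r G.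
Proof. by move=> rs [V0 cg]; split=> // S S0 ST; apply: leq_trans (cg S S0 ST). Qed.

Lemma sum_degree (G : mgraph) : \sum_(x : vert G) degree x = 2 * #|edge G|.
Proof.
have fib (h : edge G -> vert G) : \sum_x #|[set e | h e == x]| = #|edge G|.
  rewrite -sum1_card (partition_big h predT) //=.
  by apply: eq_bigr => x _; rewrite -sum1_card; apply: eq_bigl => e; rewrite inE.
by rewrite big_split /= !fib mul2n addnn.
Qed.

Lemma cut1_degree (G : mgraph) (v : vert G) :
  #|cut [set v]| + 2 * #|[set e | (src e == v) && (tgt e == v)]| = degree v.
Proof.
rewrite /degree /cut !card_set_sum big_distrr -!big_split; apply: eq_bigr => e _ /=.
by rewrite !inE; do 2 case: (_ == v).
Qed.

Lemma exists_superset_card (T : finType) (A : {set T}) (r : nat) :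
  #|A| <= r -> r <= #|T| -> exists2 B : {set T}, A \subset B & #|B| = r.
Proof.
elim: r => [|r IH]; first by move=> A0 _; exists A => //; apply/eqP; rewrite -leqn0.
rewrite leq_eqVlt => /orP[/eqP Ar _|Ar rT]; first by exists A.
have [B sAB Br] := IH Ar (ltnW rT).
have /set0Pn[x xB]: ~: B != set0.
  by rewrite -card_gt0; have := cardsC B; lia.
exists (x |: B); first by rewrite (subset_trans sAB) ?subsetUr.
by rewrite cardsU1 -in_setC xB Br.
Qed.

(** A cut of at most two edges could be padded to a disconnecting pair; the padding needs two edges
    in the graph. *)
Lemma ndisc2_eq0 (G : mgraph) : connected G -> 1 < #|edge G| -> ndisc 2 G = 0 ->
  cuts_geq 3 G.
Proof.
move=> /connected_cuts[V0 _] E2 /eqP; rewrite cards_eq0 => /eqP d0.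
split=> // S S0 ST; rewrite ltnNge; apply/negP=> le2.
have [F sSF F2] := exists_superset_card le2 E2.
have /setP/(_ F) := d0; rewrite !inE F2 eqxx /= => /negbT/negP; apply.
by apply/connected_delPn => //; exists S.
Qed.

(** * Chain decompositions *)

(* [branch x] is the image of the vertex x of D; the chain of e visits
   [pt e 0], ..., [pt e (l e)], and g is the edge number [pos g] of the chain of
   [chain g], joining [pt (chain g) (pos g)] to the next point. *)
Record chain_model (D : mgraph) (l : edge D -> nat) (G : mgraph) := ChainModel {
  branch : vert D -> vert G;
  pt : edge D -> nat -> vert G;
  chain : edge G -> edge D;
  pos : edge G -> nat;
  branch_eq : forall x y, (branch x == branch y) =
    connect (adj_del (~: [set e | l e == 0])) x y;
  pt_src : forall e, pt e 0 = branch (src e);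
  pt_tgt : forall e, pt e (l e) = branch (tgt e);
  pos_lt : forall g, pos g < l (chain g);
  pos_joins : forall g, joins g (pt (chain g) (pos g)) (pt (chain g) (pos g).+1);
  pos_inj : forall g h, chain g = chain h -> pos g = pos h -> g = h;
  pos_surj : forall e i, i < l e -> exists g, chain g = e /\ pos g = i;
  pt_inj : forall e i f j, 0 < i < l e -> 0 < j < l f ->
    pt e i = pt f j -> e = f /\ i = j;
  pt_branch : forall e i x, 0 < i < l e -> pt e i <> branch x;
  model_cover : forall y,
    (exists x, y = branch x) \/ (exists e i, 0 < i < l e /\ y = pt e i)
}.

(** * Chain models and isomorphisms with the weak subdivision *)

Section ModelIso.
Variables (D : mgraph) (l : edge D -> nat) (G : mgraph).
Local Notation Z := [set e : edge D | l e == 0].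
Local Notation W := (weak_subdivide l).
Local Notation ln := (fun e : edge (contract Z) => l (val e)).

Lemma contract_repr_ex (A : contract_vert Z) : exists x, zclass Z x == val A.
Proof. by case: A => A /= /imsetP[x _ ->]; exists x. Qed.

Definition contract_repr (A : contract_vert Z) : vert D :=
  xchoose (contract_repr_ex A).

Lemma contract_reprK A : contract_proj Z (contract_repr A) = A.
Proof. by apply/val_inj/eqP/(xchooseP (contract_repr_ex A)). Qed.

Lemma contract_proj_eq x y :
  (contract_proj Z x == contract_proj Z y) = connect (adj_del (~: Z)) x y.
Proof.
have sym := adj_del_sym (~: Z).
rewrite -val_eqE /=; apply/eqP/idP => [/setP/(_ y)|cxy].
  by rewrite !inE connect0.
by apply/setP=> z; rewrite !inE (same_connect sym cxy).
Qed.

Lemma mg_iso_of_model (M : chain_model l G) : mg_iso G W.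
Proof.
(* The vertex map is built from W, where constructors can be analysed; from G it would require a
   choice. The edge map [fE] goes the other way. *)
pose hV (w : vert W) : vert G := match w with
  | inl A => branch M (contract_repr A)
  | inr (existT e i) => pt M (val e) i.+1 end.
have hV_proj x : hV (inl (contract_proj Z x)) = branch M x.
  by apply/eqP; rewrite /= branch_eq -contract_proj_eq contract_reprK.
have hV_pt (e : edge (contract Z)) j : j <= l (val e) ->
    hV (sub_pt ln e j) = pt M (val e) j.
  case: j => [|j] le; first by rewrite hV_proj pt_src.
  rewrite /sub_pt; case: insubP => [i _ <- //|]; rewrite -leqNgt => gt.
  (* Here [insub] has failed, so the index is the last one, l e, and [sub_pt] returns the target. *)
  rewrite hV_proj -pt_tgt; congr pt.
  by have := valP e; rewrite inE; lia.
have lt_pred (e : edge D) (i : 'I_(l e).-1) : 0 < i.+1 < l e.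
  by have := ltn_ord i; lia.
have hV_inj : injective hV.
  move=> [A|[e i]] [B|[f j]] /=.
  - move/eqP; rewrite branch_eq -contract_proj_eq !contract_reprK.
    by move/eqP=> ->.
  - by move/esym/(pt_branch (lt_pred _ j)).
  - by move/(pt_branch (lt_pred _ i)).
  move/(pt_inj (lt_pred _ i) (lt_pred _ j)) => [/val_inj ef].
  by case: f / ef j => j [/val_inj ->].
have hV_surj y : exists w, hV w = y.
  have [[x ->]|[e [[|i] [ie ->]]]] := model_cover M y => //.
    by exists (inl (contract_proj Z x)).
  have eZ : e \notin Z by rewrite inE; lia.
  have ilt : i < (l e).-1 by lia.
  by exists (inr (existT (fun e : edge (contract Z) => 'I_(l (val e)).-1)
                         (exist _ e eZ) (Ordinal ilt))).
have chZ g : chain M g \notin Z by rewrite inE; have := pos_lt M g; lia.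
pose fE g : edge W :=
  existT (fun e : edge (contract Z) => 'I_(l (val e)))
         (exist _ (chain M g) (chZ g)) (Ordinal (pos_lt M g)).
have fE_inj : injective fE.
  move=> g h gh; apply: (pos_inj (c := M)).
    by have := congr1 (fun w : edge W => val (tag w)) gh.
  by have := congr1 (fun w : edge W => val (tagged w)) gh.
have fE_surj w : exists g, fE g = w.
  case: w => e i; have [g [ge gi]] := pos_surj M (ltn_ord i).
  exists g; rewrite /fE.
  have ee : exist _ (chain M g) (chZ g) = e by apply: val_inj.
  case: e / ee i ge gi => i _ gi; congr existT; exact: val_inj.
have [fV hVK fVK] : bijective hV.
  apply: inj_card_bij => //; rewrite -(card_codom hV_inj).
  by apply/subset_leq_card/subsetP=> y _; apply/codomP; have [w <-] := hV_surj y; exists w.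
exists fV, fE; split; [by exists hV| |].
  apply: inj_card_bij => //; rewrite -(card_codom fE_inj).
  by apply/subset_leq_card/subsetP=> y _; apply/codomP; have [w <-] := fE_surj y; exists w.
move=> g.
have se : src (fE g) = fV (pt M (chain M g) (pos M g)).
  by rewrite -(hV_pt (tag (fE g))) ?hVK //= ltnW ?pos_lt.
have te : tgt (fE g) = fV (pt M (chain M g) (pos M g).+1).
  by rewrite -(hV_pt (tag (fE g))) ?hVK //= pos_lt.
rewrite se te; case/orP: (pos_joins M g) => /andP[/eqP-> /eqP->]; by [left|right].
Qed.

Lemma model_of_mg_iso : mg_iso G W -> inhabited (chain_model l G).
Proof.
move=> [fV [fE [[gV fVK gVK] [gE fEK gEK] fj]]].
pose br x := gV (inl (contract_proj Z x)).
(* An edge of length zero does not survive the contraction, so [insub] fails on it; its chain is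
   then the single point [br (src e)]. *)
pose q e j := if insub e is Some e' then gV (sub_pt ln e' j) else br (src e).
have qZ (e : edge (contract Z)) j : q (val e) j = gV (sub_pt ln e j).
  by rewrite /q valK.
have gV_inj := can_inj gVK.
have sub_in (e : edge (contract Z)) i : 0 < i < l (val e) ->
    exists2 i' : 'I_(l (val e)).-1, sub_pt ln e i = inr (existT (fun e : edge (contract Z) => 'I_(l (val e)).-1) e i') & i = i'.+1.
  case: i => // i lti; rewrite /sub_pt; case: insubP => [i' _ <-|]; first by exists i'.
  by move/negP; lia.
have nZ e i : 0 < i < l e -> e \notin Z by rewrite inE; lia.
have qin e i (ie : 0 < i < l e) : exists e', exists2 i' : 'I_(l (val e')).-1,
    q e i = gV (inr (existT (fun e : edge (contract Z) => 'I_(l (val e)).-1) e' i')) & e = val e' /\ i = i'.+1.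
  pose e' : edge (contract Z) := exist _ e (nZ e i ie).
  have [i' E1 E2] := @sub_in e' i ie.
  by exists e', i' => //; rewrite (qZ e') E1.
constructor.
apply: (@ChainModel D l G br q (fun g => val (tag (fE g)))
         (fun g => nat_of_ord (tagged (fE g)))).
- by move=> x y; rewrite (inj_eq gV_inj) -contract_proj_eq.
- by move=> e; rewrite /q; case: (insubP (edge (contract Z)) e) => // e' _ <-.
- move=> e; rewrite /q; case: (insubP (edge (contract Z)) e) => [e' eZ <-|].
    have e'0: 0 < l (val e') by have := valP e'; rewrite inE lt0n.
    rewrite -[X in sub_pt _ _ X](prednK e'0) /sub_pt; case: insubP => //.
    by rewrite ltnn.
  rewrite negbK inE => e0; apply/eqP; rewrite (inj_eq gV_inj).
  change (contract_proj Z (src e) == contract_proj Z (tgt e)).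
  rewrite contract_proj_eq connect1 //; apply/adj_delP.
  by exists e; rewrite ?joins_src_tgt // !inE negbK.
- by move=> g; exact: ltn_ord.
- move=> g; rewrite !qZ; have := fj g.
  change (src (fE g)) with (sub_pt ln (tag (fE g)) (tagged (fE g))).
  change (tgt (fE g)) with (sub_pt ln (tag (fE g)) (tagged (fE g)).+1).
  by rewrite /joins => -[][-> ->]; rewrite !fVK !eqxx ?orbT.
- move=> g h gh ij; apply: (can_inj fEK).
  case: (fE g) (fE h) gh ij => e i [f j] /= /val_inj ef.
  by case: f / ef j => j /val_inj ->.
- move=> e i ie; have eZ : e \notin Z by rewrite inE; lia.
  exists (gE (existT (fun e : edge (contract Z) => 'I_(l (val e)))
                     (exist _ e eZ) (Ordinal ie))).
  by rewrite gEK.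
- move=> e i f j ie jf; have [e' [i' -> [-> ->]]] := qin _ _ ie.
  have [f' [j' -> [-> ->]]] := qin _ _ jf.
  (* [key] forgets the dependent typing, so that equal interior vertices yield equal edges and
     indices without transport. *)
  move=> /gV_inj E; pose key (w : vert W) := if w is inr u then
    Some (val (tag u), nat_of_ord (tagged u)) else None.
  by have [ef ij] := congr1 key E; split=> //; congr _.+1.
- by move=> e i x ie; have [e' [i' -> _]] := qin _ _ ie; move/gV_inj.
move=> y; rewrite -[y]fVK; case: (fV y) => [A|[e i]].
  by left; exists (contract_repr A); rewrite /br contract_reprK.
right; exists (val e), i.+1.
have ie : 0 < i.+1 < l (val e) by have := ltn_ord i; lia.
split=> //; have [i' E1 [E2]] := sub_in _ _ ie.
by rewrite qZ E1 (val_inj E2 : i = i').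
Qed.

End ModelIso.

Lemma weak_subdivide_model (D : mgraph) (l : edge D -> nat) :
  inhabited (chain_model l (weak_subdivide l)).
Proof.
by apply: model_of_mg_iso; exists id, id; split; [exists id|exists id|left].
Qed.

(** * Disconnecting pairs and chains *)

Section ModelCount.
Variables (D : mgraph) (l : edge D -> nat) (G : mgraph) (M : chain_model l G).

Definition chain_edges (e : edge D) : {set edge G} := [set g | chain M g == e].

Lemma card_chain_edges e : #|chain_edges e| = l e.
Proof.
rewrite cardE -(size_map (pos M)) -[RHS](size_iota 0); apply/perm_size/uniq_perm.
- rewrite map_inj_in_uniq ?enum_uniq // => g h.
  by rewrite !mem_enum !inE => /eqP ge /eqP he; apply: pos_inj; rewrite ge he.
- exact: iota_uniq.
move=> i; rewrite mem_iota /= add0n; apply/mapP/idP => [[g]|/(pos_surj M)[g [ge gi]]].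
  by rewrite mem_enum inE => /eqP <- ->; exact: pos_lt.
by exists g; rewrite ?gi // mem_enum inE ge.
Qed.

Lemma sum_chain_lengths : \sum_e l e = #|edge G|.
Proof.
rewrite -sum1_card (partition_big (chain M) predT) //=; apply: eq_bigr => e _.
by rewrite -card_chain_edges -sum1_card; apply: eq_bigl => g; rewrite inE.
Qed.

Definition chain_pairs : {set {set edge G}} :=
  [set F : {set edge G} | (#|F| == 2) && [exists e, F \subset chain_edges e]].

Definition disc_pairs : {set {set edge G}} :=
  [set F : {set edge G} | (#|F| == 2) && ~~ connected_del F].

(** The chains are disjoint, so a pair lies in at most one of them: after exchanging the sums, each
    pair contributes 0 or 1. *)
Lemma card_chain_pairs : #|chain_pairs| = \sum_e 'C(l e, 2).
Proof.
under eq_bigr => e _ do rewrite -card_chain_edges -cards_draws -sum1dep_card big_mkcond.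
rewrite exchange_big -sum1_card big_mkcond; apply: eq_bigr => F _ /=; rewrite inE.
case F2: (#|F| == 2); rewrite /= -big_mkcondr /=; last first.
  by rewrite big_pred0 // => e; rewrite andbF.
case: existsP => [[e Fe]|Fn]; last first.
  by rewrite big_pred0 // => e; apply/negP => /andP[Fe _]; apply: Fn; exists e.
rewrite (big_pred1 e) // => f /=; rewrite andbT; apply/idP/eqP => [Ff|-> //].
have /card_gt0P[g gF] : 0 < #|F| by rewrite (eqP F2).
by have := subsetP Fe g gF; have := subsetP Ff g gF; rewrite !inE => /eqP-> /eqP.
Qed.

Lemma pt_inj_le e i f j : 0 < i < l e -> j <= l f ->
  pt M e i = pt M f j -> e = f /\ i = j.
Proof.
move=> ie jf; have [j0|j0] := posnP j.
  by rewrite j0 pt_src => /(pt_branch ie).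
have [jl|jl] := eqVneq j (l f); first by rewrite jl pt_tgt => /(pt_branch ie).
by apply: pt_inj; rewrite // j0 ltn_neqAle jl.
Qed.

(* The part of a chain lying between two of its edges is a set whose only
   crossing edges are these two. *)
Lemma chain_pairs_disc : 0 < #|vert D| -> chain_pairs \subset disc_pairs.
Proof.
move=> /card_gt0P[x0 _]; apply/subsetP=> F; rewrite !inE => /andP[F2 /existsP[e Fe]].
rewrite F2 /=; have V0: 0 < #|vert G| by apply/card_gt0P; exists (branch M x0).
have /cards2P[a [b [ab defF]]] := F2.
wlog lt : a b ab defF / pos M a < pos M b.
  move=> IH; have [/IH -> //|/IH -> //|E] := ltngtP (pos M a) (pos M b).
  - by rewrite eq_sym.
  - by rewrite setUC.
  case/negP: ab; apply/eqP/(pos_inj _ E).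
  have /andP[] : (a \in chain_edges e) && (b \in chain_edges e).
    by rewrite !(subsetP Fe) // defF !inE eqxx ?orbT.
  by rewrite !inE => /eqP-> /eqP->.
have /eqP ca : chain M a == e by have := subsetP Fe a; rewrite inE defF !inE eqxx; apply.
have /eqP cb : chain M b == e by have := subsetP Fe b; rewrite inE defF !inE eqxx orbT; apply.
have lb : pos M b < l e by rewrite -cb pos_lt.
(* Edge number i joins points i and i + 1, so the points between a and b run from [pos M a] + 1 to
   [pos M b]. All of them are interior to the chain. *)
pose S := [set y | [exists t : 'I_(l e), (pos M a < t <= pos M b) && (y == pt M e t)]].
have inS f j : j <= l f ->
    (pt M f j \in S) = (f == e) && (pos M a < j <= pos M b).
  move=> jf; rewrite inE; apply/existsP/andP => [[t /andP[/andP[at_ tb] /eqP E]]|[/eqP fe /andP[aj jb]]].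
    have t0 : 0 < t < l e by have := ltn_ord t; lia.
    have [<- <-] := pt_inj_le t0 jf (esym E).
    by rewrite eqxx at_.
  have jl : j < l e by lia.
  by exists (Ordinal jl) => /=; rewrite aj jb fe eqxx.
apply/connected_delPn => //; exists S; split.
- apply/set0Pn; exists (pt M e (pos M b)); rewrite inS ?eqxx //=; lia.
- apply/negP=> /eqP/setP/(_ (branch M (src e))); rewrite in_setT -pt_src inS //.
  by rewrite ltn0 andbF.
apply/subsetP=> g; rewrite (in_cut_joins _ (pos_joins M g)).
rewrite !inS ?pos_lt ?(ltnW (pos_lt _ _)) //.
have [ge|] := eqVneq (chain M g) e => //= gn.
have: pos M g = pos M a \/ pos M g = pos M b by lia.
rewrite defF !inE => -[] /pos_inj->; rewrite ?eqxx ?orbT ?ca ?cb //.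
Qed.

Lemma sum_bin_le_ndisc : 0 < #|vert D| -> \sum_e 'C(l e, 2) <= ndisc 2 G.
Proof.
by move=> D0; rewrite -card_chain_pairs; apply/subset_leq_card/chain_pairs_disc.
Qed.

(** A discrete intermediate value argument along the chain. *)
Lemma chain_crossing (S : {set vert G}) e i j :
  i <= j -> j <= l e -> (pt M e i \in S) != (pt M e j \in S) ->
  exists g, [/\ g \in cut S, chain M g = e & i <= pos M g < j].
Proof.
elim: j => [|j IH]; first by rewrite leqn0 => /eqP->; rewrite eqxx.
rewrite leq_eqVlt => /orP[/eqP->|]; first by rewrite eqxx.
rewrite ltnS => ij je nij.
have [E|nE] := eqVneq (pt M e i \in S) (pt M e j \in S); last first.
  by have [g [gS ge gi]] := IH ij (ltnW je) nE; exists g; split=> //; lia.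
have [g [ge gj]] := pos_surj M je.
exists g; split=> //; last by rewrite gj; lia.
by rewrite (in_cut_joins _ (pos_joins M g)) ge gj -E.
Qed.

(** One side of the disconnection contains no branch vertex, since its trace on D has a cut of at
    most two edges. It then contains an interior point of some chain, and that chain crosses the cut
    both before and after this point. *)
Lemma disc_pairs_chain : cuts_geq 3 D -> disc_pairs \subset chain_pairs.
Proof.
move=> [D0 cD]; apply/subsetP=> F; rewrite !inE => /andP[F2 nF].
rewrite F2 /=; have V0: 0 < #|vert G|.
  by case/card_gt0P: D0 => x0 _; apply/card_gt0P; exists (branch M x0).
have [S [S0 ST sSF]] := connected_delPn _ V0 nF.
(* Each edge of D in the cut of the trace [S1] has a crossing edge of its own in F, so [S1] is empty
   or everything; in the latter case the complement of S serves. *)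
wlog p0 : S S0 ST sSF / forall x, branch M x \notin S.
  move=> IH; pose S1 := [set x | branch M x \in S].
  have: #|cut S1| < 3.
    rewrite ltnS -(eqP F2).
    have /subset_leq_card : cut S1 \subset [set chain M g | g in F].
      apply/subsetP=> e; rewrite !inE -pt_src -pt_tgt => /chain_crossing-/(_ (leq0n _) (leqnn _)).
      by move=> [g [gS <- _]]; apply: imset_f; apply: (subsetP sSF).
    by move/leq_trans; apply; exact: leq_imset_card.
  rewrite ltnNge; apply: contraR => nE.
  have nS T : T != set0 -> T != setT -> cut T \subset F -> ~ (forall x, branch M x \notin T).
    by move=> ? ? ? ?; case/negP: nE; exact: (IH T).
  apply: cD.
    apply/negP=> /eqP E; apply: (nS S) => // x.
    by have /setP/(_ x) := E; rewrite !inE => ->.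
  apply/negP=> /eqP E; apply: (nS (~: S)); rewrite ?cutC //.
  - by rewrite setC_eq0.
  - by rewrite setC_eqT.
  by move=> x; have /setP/(_ x) := E; rewrite !inE => ->.
have /set0Pn[y yS] := S0.
have [[x E]|[e [t [te E]]]] := model_cover M y.
  by have := p0 x; rewrite -E yS.
rewrite E in yS; apply/existsP; exists e.
have [a [aS ae a1]] : exists g, [/\ g \in cut S, chain M g = e & 0 <= pos M g < t].
  by apply: chain_crossing; rewrite ?yS ?pt_src ?(negPf (p0 _)) //; lia.
have [b [bS be b1]] : exists g, [/\ g \in cut S, chain M g = e & t <= pos M g < l e].
  by apply: chain_crossing; rewrite ?yS ?pt_tgt ?(negPf (p0 _)) //; lia.
have ab : a != b by apply/eqP=> ab; rewrite ab in a1; lia.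
have <- : [set a; b] = F.
  apply/eqP; rewrite eqEcard cards2 ab (eqP F2) leqnn andbT.
  by apply/subsetP=> g; rewrite !inE => /orP[]/eqP->; apply: (subsetP sSF).
by apply/subsetP=> g; rewrite !inE => /orP[]/eqP->; rewrite ?ae ?be.
Qed.

Lemma ndisc2_model : cuts_geq 3 D -> ndisc 2 G = \sum_e 'C(l e, 2).
Proof.
move=> cD; rewrite -card_chain_pairs; apply: eq_card; apply/setP/eqP.
by rewrite eqEsubset disc_pairs_chain // chain_pairs_disc //; case: cD.
Qed.

(** A cut of D with at most two edges, padded to a pair e, f, would give a disconnecting pair with
    one edge on each of two chains; the count leaves room only for pairs on one chain. *)
Lemma cuts_geq3_of_chain_pairs : (forall e, 0 < l e) -> connected G ->
  0 < #|vert D| -> 1 < #|edge D| -> ndisc 2 G = \sum_e 'C(l e, 2) -> cuts_geq 3 D.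
Proof.
move=> l0 /connected_cuts[V0 _] D0 E2 dE; split=> // S0 S0n S0T.
rewrite ltnNge; apply/negP=> /exists_superset_card-/(_ E2)[B sB B2].
have eqP2 : chain_pairs = disc_pairs.
  by apply/eqP; rewrite eqEcard chain_pairs_disc // card_chain_pairs -dE leqnn.
have branch_inj x y : branch M x = branch M y -> x = y.
  move/eqP; rewrite branch_eq => cxy; apply/eqP; rewrite -in_set1.
  rewrite (connect_cut (S := [set y]) cxy) ?inE //.
  by apply/subsetP=> e; rewrite !inE -lt0n l0.
(* Each source in [S0] takes along its whole chain except the target, so only the last edge of a
   chain can cross, and only if the chain belongs to [cut S0]. *)
pose S := [set y | [exists x in S0, y == branch M x] ||
  [exists e, (src e \in S0) && [exists t : 'I_(l e), (0 < t) && (y == pt M e t)]]].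
have inS_branch x : (branch M x \in S) = (x \in S0).
  rewrite inE; apply/orP/idP => [[/existsP[x' /andP[x'S /eqP/branch_inj->]] //|]|xS].
    move=> /existsP[e /andP[_ /existsP[t /andP[t0 /eqP E]]]].
    by case: (@pt_branch _ _ _ M e t x) => //; rewrite t0 ltn_ord.
  by left; apply/existsP; exists x; rewrite xS eqxx.
have inS e t : t < l e -> (pt M e t \in S) = (src e \in S0).
  move=> te; have [->|t0] := posnP t; first by rewrite pt_src inS_branch.
  have tl: 0 < t < l e by rewrite t0.
  rewrite inE; apply/orP/idP => [[/existsP[x /andP[_ /eqP/(pt_branch tl)]] //|]|eS].
    move=> /existsP[f /andP[fS /existsP[t' /andP[t'0 /eqP E]]]].
    by have [|-> _] := pt_inj tl _ E; rewrite // t'0 ltn_ord.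
  right; apply/existsP; exists e; rewrite eS; apply/existsP; exists (Ordinal te).
  by rewrite t0 eqxx.
have cutS g : g \in cut S -> chain M g \in cut S0 /\ (pos M g).+1 = l (chain M g).
  rewrite (in_cut_joins _ (pos_joins M g)) inS ?pos_lt //.
  have := pos_lt M g; rewrite leq_eqVlt => /orP[/eqP gl|gl].
    by rewrite gl pt_tgt inS_branch inE.
  by rewrite inS ?eqxx.
have /cards2P[e [f [ef defB]]] : #|B| == 2 by rewrite B2.
have last_edge h : exists g, chain M g = h /\ (pos M g).+1 = l h.
  have [|g [gh gl]] := @pos_surj _ _ _ M h (l h).-1; first by rewrite prednK ?l0.
  by exists g; rewrite gl prednK ?l0.
have last_uniq g h : chain M g = chain M h -> pos M g = pos M h -> g = h.
  exact: pos_inj.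
have [a [ae al]] := last_edge e; have [b [bf bl]] := last_edge f.
have ab : a != b by apply: contraNneq ef => ab; rewrite -ae ab bf.
have : [set a; b] \in disc_pairs.
  rewrite inE cards2 ab /=; apply/connected_delPn => //; exists S; split.
  - by case/set0Pn: S0n => x xS; apply/set0Pn; exists (branch M x); rewrite inS_branch.
  - apply: contraNneq S0T => /setP ST; apply/eqP/setP=> x.
    by rewrite -inS_branch ST !inE.
  apply/subsetP=> g /cutS[/(subsetP sB)]; rewrite defB !inE => /orP[]/eqP ge; rewrite ge => gl.
    by rewrite (last_uniq g a) ?eqxx ?ge ?ae //; lia.
  by rewrite (last_uniq g b) ?eqxx ?orbT ?ge ?bf //; lia.
rewrite -eqP2 inE cards2 ab => /existsP[h /subsetP sh].
have := sh a; have := sh b; rewrite !inE !eqxx ?orbT => /(_ isT)/eqP hb /(_ isT)/eqP ha.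
by case/eqP: ef; rewrite -ae ha -hb.
Qed.

End ModelCount.

(** * Contracting and inserting a vertex *)

Section ContractEdge.
Variables (G : mgraph) (f : edge G) (v u : vert G).
Hypotheses (fvu : joins f v u) (uv : u != v).

Definition redirect_vert : finType := {x : vert G | x != v}.

(** Contraction without a quotient: v is discarded and u, the default value of [insubd], takes its
    place. *)
Definition redirect (x : vert G) : redirect_vert := insubd (exist _ u uv) x.

Lemma val_redirect x : val (redirect x) = if x == v then u else x.
Proof. by rewrite val_insubd; case: (x == v). Qed.

Definition contract_edge : mgraph :=
  @MGraph redirect_vert {e : edge G | e != f}
    (fun e => redirect (src (val e))) (fun e => redirect (tgt (val e))).

Lemma card_vert_contract_edge : #|vert contract_edge| = #|vert G|.-1.
Proof. by rewrite card_sig -(cardC1 v); apply: eq_card => x; rewrite !inE. Qed.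

Lemma card_edge_contract_edge : #|edge contract_edge| = #|edge G|.-1.
Proof. by rewrite card_sig -(cardC1 f); apply: eq_card => x; rewrite !inE. Qed.

(** A preimage under [redirect] never separates v from u, so f does not cross it. *)
Lemma cut_contract_edge (S : {set vert contract_edge}) :
  cut (redirect @^-1: S) = val @: cut S.
Proof.
apply/setP=> e; apply/idP/imsetP => [eS|[e' eS ->]]; last by move: eS; rewrite !inE.
have ef : e != f.
  apply: contraTneq eS => ->; rewrite (in_cut_joins _ fvu) !inE negbK.
  suff -> : redirect v = redirect u by [].
  by apply: val_inj; rewrite !val_redirect eqxx (negPf uv).
by exists (exist _ e ef) => //; move: eS; rewrite !inE.
Qed.

Lemma redirect_val (x : redirect_vert) : redirect (val x) = x.
Proof. by apply: val_inj; rewrite val_redirect (negPf (valP x)). Qed.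

Lemma preim_redirect_neq0 (S : {set vert contract_edge}) :
  S != set0 -> redirect @^-1: S != set0.
Proof.
by case/set0Pn=> x xS; apply/set0Pn; exists (val x); rewrite inE redirect_val.
Qed.

Lemma preim_redirect_neqT (S : {set vert contract_edge}) :
  S != setT -> redirect @^-1: S != setT.
Proof. by rewrite -!setC_eq0 -preimsetC; exact: preim_redirect_neq0. Qed.

Lemma cuts_geq_contract_edge r : cuts_geq r G -> cuts_geq r contract_edge.
Proof.
move=> [V0 cg]; split; first by apply/card_gt0P; exists (redirect u).
move=> S S0 ST; rewrite -(card_imset _ val_inj) -cut_contract_edge.
by apply: cg; [exact: preim_redirect_neq0|exact: preim_redirect_neqT].
Qed.

(* Every pair containing the bridge f disconnects. *)
Lemma ndisc2_contract_bridge (S : {set vert G}) : 0 < #|vert G| ->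
  S != set0 -> S != setT -> cut S = [set f] ->
  #|edge G|.-1 + ndisc 2 contract_edge <= ndisc 2 G.
Proof.
move=> V0 S0 ST cS; pose A := [set [set f; g] | g in [set~ f]].
(* [A] holds the pairs containing f; [B] holds pairs lifted from the contraction, which avoid f. *)
pose B := [set val @: (F : {set edge contract_edge}) | F in
  [set F : {set edge contract_edge} | (#|F| == 2) && ~~ connected_del F]].
have V'0: 0 < #|vert contract_edge| by apply/card_gt0P; exists (redirect u).
have cA : #|A| = #|edge G|.-1.
  rewrite card_in_imset ?cardsC1 // => g h; rewrite !inE => gf hf /setP/(_ g).
  by rewrite !inE eqxx orbT (negPf gf) => /esym/eqP.
have cB : #|B| = ndisc 2 contract_edge.
  by rewrite card_imset //; apply: imset_inj; exact: val_inj.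
have AB : A :&: B = set0.
  apply/eqP; rewrite setI_eq0; apply/pred0P => F /=; apply/negP.
  move=> /andP[/imsetP[g _ ->] /imsetP[F' _ /setP/(_ f)]].
  rewrite !inE eqxx => /esym/imsetP[e _ fe].
  by have := valP e; rewrite -fe eqxx.
have := cardsUI A B; rewrite AB cards0 addn0 -cA -cB => <-.
apply/subset_leq_card/subsetP=> F; rewrite in_setU inE => /orP[/imsetP[g gf ->]|].
  rewrite !inE in gf; rewrite cards2 (eq_sym f) gf; apply/connected_delPn => //.
  by exists S; rewrite cS subsetUl.
move=> /imsetP[F']; rewrite inE => /andP[F2 /(connected_delPn _ V'0)[S' [S'0 S'T sSF]]] ->.
rewrite card_imset ?F2 //=; last exact: val_inj.
apply/connected_delPn => //; exists (redirect @^-1: S').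
by rewrite preim_redirect_neq0 ?preim_redirect_neqT // cut_contract_edge imsetS.
Qed.

End ContractEdge.

(** The cut already uses up the degree, so v has exactly two edges and no loop. The neighbours x and
    u may coincide. *)
Lemma degree2_neighbours (G : mgraph) (v : vert G) :
  1 < #|cut [set v]| -> degree v <= 2 ->
  exists e f x u, [/\ e != f, joins e x v, joins f v u, x != v & u != v] /\
    (forall g, g != e -> g != f -> (src g != v) && (tgt g != v)).
Proof.
rewrite -cut1_degree => c1 d2.
have /eqP/cards2P[e [f [ef cE]]] : #|cut [set v]| = 2 by lia.
have /eqP : #|[set e | (src e == v) && (tgt e == v)]| = 0 by lia.
rewrite cards_eq0 => /eqP nl.
have other g : g \in cut [set v] -> exists2 x, joins g x v & x != v.
  rewrite !inE => gv; have [E|E] := eqVneq (src g) v.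
    exists (tgt g); first by rewrite joinsC -E joins_src_tgt.
    by move: gv; rewrite E eqxx; case: (tgt g == v).
  exists (src g) => //; move: gv; rewrite (negPf E); case: (tgt g =P v) => [<- _|_ //].
  exact: joins_src_tgt.
have [|x jx xv] := other e; first by rewrite cE !inE eqxx.
have [|u ju uv] := other f; first by rewrite cE !inE eqxx orbT.
exists e, f, x, u; rewrite joinsC in ju; split=> //.
move=> g ge gf; have := cE; move/setP/(_ g); rewrite !inE (negPf ge) (negPf gf) /=.
have := nl; move/setP/(_ g); rewrite !inE.
by do 2 case: (_ == v).
Qed.

(** Index arithmetic for an insertion, where b marks the affected chain. The edge at position i
    becomes the edges i and i + 1, and later edges shift by one; point i + 1 is new, and later
    points go back to their predecessor index. *)
Lemma skip_inj (b : bool) i j k :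
  j + (b && (i < j)) = k + (b && (i < k)) -> j = k.
Proof. by case: b => /=; lia. Qed.

Lemma skip_lt (b : bool) i j m : j < m -> j + (b && (i < j)) < m + b.
Proof. by case: b => /=; lia. Qed.

Lemma skip_neq i j : j <> i -> (j + (i < j) != i) && (j + (i < j) != i.+1).
Proof. by lia. Qed.

Lemma unskip_inj (b : bool) i j k : b && (j == i.+1) = false ->
  b && (k == i.+1) = false ->
  (if b && (i.+1 < j) then j.-1 else j) = (if b && (i.+1 < k) then k.-1 else k) ->
  j = k.
Proof.
case: b; rewrite ?andTb ?andFb //.
by case: (ltnP i.+1 j) => ?; case: (ltnP i.+1 k) => ?; lia.
Qed.

Lemma unskip_interior (b : bool) i j m : (b -> i < m) -> 0 < j < m + b ->
  b && (j == i.+1) = false -> 0 < (if b && (i.+1 < j) then j.-1 else j) < m.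
Proof.
by case: b => /= [/(_ isT)|_]; last lia; case: (ltnP i.+1 j) => *; lia.
Qed.

(** * Restoring a contracted vertex of degree two on its chain *)

Section InsertVertex.
Variables (G : mgraph) (e f : edge G) (v x u : vert G).
Hypotheses (ef : e != f) (xv : x != v) (uv : u != v).
Hypotheses (exv : joins e x v) (fvu : joins f v u).
Hypothesis avoid : forall g, g != e -> g != f -> (src g != v) && (tgt g != v).
Local Notation G' := (contract_edge f uv).
Variables (D : mgraph) (l' : edge D -> nat) (M : chain_model l' G').

Let e' : edge G' := exist _ e ef.
Let c0 := chain M e'.
Let i0 := pos M e'.
(** The default of [insubd] sends f to [e'], which stands for both e and f after the contraction. *)
Let sub g : edge G' := insubd e' g.
Let l g := l' g + (g == c0).
Let skip g (j : nat) := if (g == c0) && (i0.+1 < j) then j.-1 else j.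
Let P g (j : nat) : vert G :=
  if (g == c0) && (j == i0.+1) then v else val (pt M g (skip g j)).

Let P_other g j : g != c0 -> P g j = val (pt M g j).
Proof. by rewrite /P /skip => /negPf->. Qed.

Let P_low j : j <= i0 -> P c0 j = val (pt M c0 j).
Proof. by move=> ji; rewrite /P /skip eqxx /= ltn_eqF // ltnNge leqW. Qed.

Let P_mid : P c0 i0.+1 = v.
Proof. by rewrite /P !eqxx. Qed.

Let P_high j : i0 < j -> P c0 j.+1 = val (pt M c0 j).
Proof. by move=> ij; rewrite /P /skip eqxx /= eqSS gtn_eqF // ltnS ij. Qed.

Let val_sub g : val (sub g) = if g == f then e else g.
Proof. by rewrite /sub val_insubd; case: (g == f). Qed.

Let sub_val (g : edge G') : sub (val g) = g.
Proof. by apply: val_inj; rewrite val_sub (negPf (valP g)). Qed.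

Let joins_contract (g : edge G') y z :
  joins g y z -> val g != e -> joins (val g) (val y) (val z).
Proof.
rewrite /joins -!val_eqE /= !val_redirect => jyz ge.
by case/andP: (avoid ge (valP g)) jyz => /negPf-> /negPf->.
Qed.

(** Along the chain a comes first and b second; the orientation of the chain decides which of them
    is e and which is f. *)
Let insert_aux (a b : edge G) : (a, b) = (e, f) \/ (a, b) = (f, e) ->
  joins a (val (pt M c0 i0)) v -> joins b v (val (pt M c0 i0.+1)) ->
  inhabited (chain_model l G).
Proof.
move=> abef ja jb.
have ab : a != b by case: abef => -[-> ->] //; rewrite eq_sym.
have sub_a : sub a = e' by case: abef => -[-> _]; apply: val_inj; rewrite val_sub /= ?eqxx ?(negPf ef).
have sub_b : sub b = e' by case: abef => -[_ ->]; apply: val_inj; rewrite val_sub /= ?eqxx ?(negPf ef).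
have not_ab g : g != a -> g != b -> (g != e) && (g != f).
  by case: abef => -[-> ->] -> ->.
have e'_ab (g : edge G') : g <> e' -> (val g == a = false) * (val g == b = false).
  have gf := negPf (valP g).
  move=> /eqP; rewrite -val_eqE /= => /negPf ge.
  by case: abef => -[-> ->]; rewrite ge gf.
have i0lt : i0 < l' c0 := pos_lt M e'.
pose ch g := chain M (sub g).
pose ps g := if g == a then i0 else if g == b then i0.+1 else
  pos M (sub g) + ((ch g == c0) && (i0 < pos M (sub g))).
have ch_a : ch a = c0 by rewrite /ch sub_a.
have ch_b : ch b = c0 by rewrite /ch sub_b.
have ps_a : ps a = i0 by rewrite /ps eqxx.
have ps_b : ps b = i0.+1 by rewrite /ps eq_sym (negPf ab) eqxx.
have ps_neq g : g != a -> g != b -> val (sub g) = g /\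
  (ch g = c0 -> pos M (sub g) <> i0).
  move=> ga gb; have /andP[ge gf] := not_ab g ga gb.
  have sg : val (sub g) = g by rewrite val_sub (negPf gf).
  split=> // /(pos_inj (c := M)) gi /gi E.
  by case/eqP: ge; rewrite -sg E.
have edge_cases g : [\/ g = a, g = b | g != a /\ g != b].
  by have [->|ga] := eqVneq g a; [constructor 1|have [->|gb] := eqVneq g b; [constructor 2|constructor 3]].
have psE g : g != a -> g != b ->
    ps g = pos M (sub g) + ((ch g == c0) && (i0 < pos M (sub g))).
  by rewrite /ps => /negPf-> /negPf->.
have ps_third g : g != a -> g != b -> ch g = c0 -> (ps g != i0) && (ps g != i0.+1).
  move=> ga gb E; have [_ /(_ E) ni] := ps_neq g ga gb.
  by rewrite psE // E eqxx; exact: skip_neq.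
have ps_is_a g : ch g = c0 -> ps g = i0 -> g = a.
  move=> cg pg; have [//|gb|[ga gb]] := edge_cases g.
    by move: pg; rewrite gb ps_b => /esym/n_Sn.
  by have := ps_third g ga gb cg; rewrite pg eqxx.
have ps_is_b g : ch g = c0 -> ps g = i0.+1 -> g = b.
  move=> cg pg; have [ga|//|[ga gb]] := edge_cases g.
    by move: pg; rewrite ga ps_a => /n_Sn.
  by have := ps_third g ga gb cg; rewrite pg eqxx andbF.
have vP z : val (z : vert G') <> v by exact/eqP/(valP z).
constructor.
apply: (@ChainModel D l G (fun z => val (branch M z)) P ch ps).
- move=> y z; transitivity (branch M y == branch M z); first exact: val_eqE.
  rewrite branch_eq.
  suff -> : [set g | l g == 0] = [set g | l' g == 0] by [].
  apply/setP=> g; rewrite !inE /l; have [->|_] := eqVneq g c0; last by rewrite addn0.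
  by rewrite addn1 [RHS]eqn0Ngt (leq_ltn_trans (leq0n _) i0lt).
- by move=> g; rewrite /P andbF /skip ltn0 andbF pt_src.
- move=> g; rewrite /l; have [->|nE] := eqVneq g c0; last by rewrite addn0 P_other // pt_tgt.
  by rewrite addn1 P_high // pt_tgt.
- move=> g; rewrite /l; have [->|->|[ga gb]] := edge_cases g.
  + by rewrite ch_a ps_a eqxx addn1 ltnW.
  + by rewrite ch_b ps_b eqxx addn1 ltnS.
  by rewrite psE // skip_lt // pos_lt.
- move=> g; have [->|->|[ga gb]] := edge_cases g.
  + by rewrite ch_a ps_a P_low // P_mid.
  + by rewrite ch_b ps_b P_mid P_high.
  have [sg ni] := ps_neq g ga gb.
  have ge : val (sub g) != e by rewrite sg; case/andP: (not_ab g ga gb).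
  have := joins_contract (pos_joins M (sub g)) ge; rewrite sg -/(ch g).
  rewrite psE //; have [E|nE] := eqVneq (ch g) c0; last by rewrite addn0 !P_other.
  rewrite E in ni *; have [lt|gt|/esym/ni] := ltngtP i0 (pos M (sub g)) => //.
    by rewrite addn1 !P_high // leqW.
  by rewrite addn0 !P_low // ltnW.
- move=> g h cgh pgh; have [ga|gb|[ga gb]] := edge_cases g.
  + by rewrite ga; symmetry; apply: ps_is_a; rewrite -?cgh -?pgh ga.
  + by rewrite gb; symmetry; apply: ps_is_b; rewrite -?cgh -?pgh gb.
  have [ha|hb|[ha hb]] := edge_cases h.
  + by rewrite ha; apply: ps_is_a; rewrite ?cgh ?pgh ha.
  + by rewrite hb; apply: ps_is_b; rewrite ?cgh ?pgh hb.
  have [<- _] := ps_neq g ga gb; have [<- _] := ps_neq h ha hb.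
  congr val; apply: (pos_inj (c := M)); first exact: cgh.
  by move: pgh; rewrite !psE // -cgh => /skip_inj.
- have old (g : edge G') : g <> e' -> ch (val g) = chain M g /\
    ps (val g) = pos M g + ((chain M g == c0) && (i0 < pos M g)).
    by move=> ge; rewrite /ps /ch !(e'_ab _ ge) sub_val.
  move=> g i; rewrite /l; have [->|gc] := eqVneq g c0; last first.
    rewrite addn0 => ig; have [h [hg hi]] := pos_surj M ig.
    have he : h <> e' by move=> E; case/eqP: gc; rewrite -hg E.
    by exists (val h); have [-> ->] := old h he; rewrite hg (negPf gc) hi addn0.
  rewrite addn1 ltnS => il; have [ia|ia|->] := ltngtP i i0; last by exists a.
    have [h [hg hi]] := pos_surj M (ltn_trans ia i0lt).
    have he : h <> e' by move=> E; move: ia; rewrite -hi E ltnn.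
    exists (val h); have [-> ->] := old h he.
    by rewrite hg hi eqxx ltnNge (ltnW ia) addn0.
  case: i il ia => // i il; rewrite ltnS leq_eqVlt => /orP[/eqP<-|ia]; first by exists b.
  have [h [hg hi]] := pos_surj M il.
  have he : h <> e' by move=> E; move: ia; rewrite -hi E ltnn.
  by exists (val h); have [-> ->] := old h he; rewrite hg hi eqxx ia addn1.
- have interior g j : 0 < j < l g -> (g == c0) && (j == i0.+1) = false ->
      0 < skip g j < l' g.
    by apply: unskip_interior => /eqP->.
  move=> g i h j gi hj; rewrite /P.
  case gE: (_ && (i == _)); case hE: (_ && (j == _)).
  + by move: gE hE => /andP[/eqP-> /eqP->] /andP[/eqP-> /eqP->].
  + by move/esym/vP.
  + by move/vP.
  move=> /val_inj pij.
  have [gh sk] := pt_inj (c := M) (interior _ _ gi gE) (interior _ _ hj hE) pij.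
  by rewrite -gh in hE sk *; split=> //; exact: unskip_inj gE hE sk.
- move=> g i z gi; rewrite /P; case gE: (_ && _); first by move/esym/vP.
  by move=> /val_inj; apply: (pt_branch (c := M)); apply: unskip_interior => // /eqP->.
move=> y; have [->|yv] := eqVneq y v.
  by right; exists c0, i0.+1; rewrite P_mid /l eqxx addn1.
have [[z E]|[g [i [gi E]]]] := model_cover M (exist _ y yv).
  by left; exists z; rewrite -E.
have yE : y = val (pt M g i) by rewrite -E.
right; exists g, (i + ((g == c0) && (i0 < i))); rewrite /l yE.
have [gc|gc] := eqVneq g c0; last by rewrite !addn0 P_other.
rewrite gc in gi *; have [lt|ge] := ltnP i0 i.
  by rewrite !addn1 P_high //; case/andP: gi => _ gi; split.
by rewrite addn0 P_low // addn1 ltnS; case/andP: gi => -> /ltnW.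
Qed.

(** The bound on l' keeps positive lengths positive through the induction of [model_exists]. *)
Lemma insert_vertex : exists2 l : edge D -> nat, (forall g, l' g <= l g) &
  inhabited (chain_model l G).
Proof.
exists l; first by move=> g; rewrite leq_addr.
have se : joins e' (redirect uv x) (redirect uv v).
  rewrite /joins /e' /=; case/orP: exv => /andP[/eqP-> /eqP->]; rewrite !eqxx ?orbT //.
have ends : (val (pt M c0 i0) = x /\ val (pt M c0 i0.+1) = u) \/
            (val (pt M c0 i0) = u /\ val (pt M c0 i0.+1) = x).
  have mx : val (redirect uv x) = x by rewrite val_redirect (negPf xv).
  have mv : val (redirect uv v) = u by rewrite val_redirect eqxx.
  have := pos_joins M e'; rewrite -/c0 -/i0 /joins.
  case/orP: se => /andP[/eqP-> /eqP->] /orP[]/andP[/eqP<- /eqP<-]; rewrite mx mv; by [left|right].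
have [[E1 E2]|[E1 E2]] := ends.
  by apply: (@insert_aux e f); [left|rewrite E1|rewrite E2].
by apply: (@insert_aux f e); [right|rewrite E1 joinsC|rewrite E2 joinsC].
Qed.

End InsertVertex.

(** * The lower bound *)

Lemma identity_model (G : mgraph) :
  inhabited (chain_model (fun _ : edge G => 1) G).
Proof.
constructor.
apply: (@ChainModel G _ G id (fun e i => if i is 0 then src e else tgt e) id (fun _ => 0)) => //.
- move=> x y; apply/eqP/idP => [->|cxy]; first exact: connect0.
  apply/eqP; rewrite -in_set1 (connect_cut (S := [set y]) cxy) ?inE //.
  by apply/subsetP=> e; rewrite !inE.
- by move=> g; exact: joins_src_tgt.
- by move=> e [|i] // _; exists e.
- by move=> e [|[|i]] //.
- by move=> e [|[|i]] //.
by move=> y; left; exists y.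
Qed.

(** Contracting an edge at a vertex of degree two keeps the difference k and creates no bridge;
    [insert_vertex] then puts the vertex back on a chain. *)
Lemma model_exists (k : nat) (G : mgraph) : 0 < k -> cuts_geq 2 G ->
  #|edge G| = #|vert G| + k ->
  exists (H : mgraph) (l : edge H -> nat),
    [/\ inhabited (chain_model l G), forall e, 0 < l e, 0 < #|vert H|,
        #|edge H| = #|vert H| + k & forall x : vert H, 3 <= degree x].
Proof.
move=> k0; move En: #|vert G| => n; elim: n G En => [|n IH] G En cG Em.
  by have [] := cG; rewrite En.
have [d3|/forallPn[v]] := boolP [forall x : vert G, 3 <= degree x].
  exists G, (fun=> 1); split; rewrite ?En //; first exact: identity_model.
  by move=> x; apply: (forallP d3).
rewrite -leqNgt => dv.
(* A lone vertex carries k + 1 loops, so its degree is at least four, contrary to [dv]. *)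
have [n0|n0] := posnP n.
  have /fintype_le1P/(_ v) all_v : #|vert G| <= 1 by rewrite En n0.
  have : degree v = #|edge G| + #|edge G|.
    by congr (_ + _); apply: eq_card => e; rewrite inE; apply/eqP; exact: all_v.
  by lia.
have c1 : 1 < #|cut [set v]|.
  apply: cG.2; first by apply/set0Pn; exists v; rewrite inE.
  by apply/negP=> /eqP E; have := cards1 v; rewrite E cardsT; lia.
have [e [f [x [u [[ef jx ju xv uv] av]]]]] := degree2_neighbours c1 dv.
have [|||H [l [[M] l0 H0 EH dH]]] := IH (contract_edge f uv).
- by rewrite card_vert_contract_edge En.
- exact: cuts_geq_contract_edge.
- by rewrite card_edge_contract_edge; lia.
have [l2 ll2 M2] := insert_vertex ef xv jx ju av M.
by exists H, l2; split=> // g; apply: leq_trans (ll2 g).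
Qed.

Lemma double_bin2 n : 2 * 'C(n, 2) + n = n * n.
Proof. by elim: n => // n IH; rewrite binS bin1; nia. Qed.

(** The doubled gap is (x - q)(x - q - 1), a product of consecutive integers, hence nonnegative; d
    is the distance from x to the set {q, q + 1}. *)
Lemma bin2_gap q x : exists2 d,
  2 * ('C(x, 2) + 'C(q.+1, 2)) = 2 * (q * x) + d * d.+1 &
  (d == 0) = (x == q) || (x == q.+1).
Proof.
have Ex := double_bin2 x; have Eq := double_bin2 q.+1.
have [xq|qx] := leqP x q.
  exists (q - x); last by lia.
  by move: (q - x) (subnKC xq) Eq => d <-; lia.
exists (x - q.+1); last by lia.
by move: (x - q.+1) (subnKC qx) Ex => d <-; lia.
Qed.

(** The [leqif] form lets the equality case survive summation over the chains. *)
Lemma bin2_tangent q x :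
  q * x <= 'C(x, 2) + 'C(q.+1, 2) ?= iff (x == q) || (x == q.+1).
Proof.
have [d E <-] := bin2_gap q x; split; first by lia.
by apply/eqP/eqP => [Eq|d0]; [nia|rewrite d0 in E; lia].
Qed.

Lemma sum_bin2_tangent (T : finType) (l : T -> nat) q :
  q * \sum_e l e <= \sum_e 'C(l e, 2) + #|T| * 'C(q.+1, 2)
    ?= iff [forall e, (l e == q) || (l e == q.+1)].
Proof.
rewrite big_distrr -sum_nat_const -big_split /=.
by apply: leqif_sum => e _; exact: bin2_tangent.
Qed.

(** Degree count: 3 |V| <= 2 |E|, combined with |V| = |E| - k. *)
Lemma card_of_degree_geq3 (k : nat) (H : mgraph) :
  #|edge H| = #|vert H| + k -> (forall x : vert H, 3 <= degree x) ->
  #|edge H| <= 3 * k.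
Proof.
move=> EH dH; have : #|vert H| * 3 <= 2 * #|edge H|.
  by rewrite -sum_nat_const -sum_degree; apply: leq_sum => x _.
by lia.
Qed.

Lemma cubic_of_card (k : nat) (H : mgraph) :
  #|vert H| = 2 * k -> #|edge H| = 3 * k -> (forall x : vert H, 3 <= degree x) ->
  cubic H.
Proof.
move=> VH EH dH.
have /leqif_sum [_] : forall x : vert H, true -> 3 <= degree x ?= iff (degree x == 3).
  by move=> x _; split; rewrite // eq_sym.
rewrite sum_nat_const sum_degree EH VH mulnAC mulnA eqxx.
by move/esym/forallP => d3; apply/forallP=> x; have := d3 x.
Qed.

(** Vertices and edges both drop by one, so k is unchanged and induction applies. *)
Lemma bridge_gain (G : mgraph) : cuts_geq 1 G -> ~ cuts_geq 2 G ->
  exists G' : mgraph, [/\ cuts_geq 1 G', #|vert G| = #|vert G'|.+1,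
    #|edge G| = #|edge G'|.+1 & #|edge G'| + ndisc 2 G' <= ndisc 2 G].
Proof.
move=> cG n2; have V0 := cG.1.
have [|noS] := boolP [exists S : {set vert G}, [&& S != set0, S != setT & #|cut S| == 1]].
  move=> /existsP[S /and3P[S0 ST /cards1P[f cS]]].
  have fS : f \in cut S by rewrite cS set11.
  have uv : src f != tgt f by apply: contraTneq fS => E; rewrite inE E eqxx.
  have jf : joins f (tgt f) (src f) by rewrite joinsC joins_src_tgt.
  have E0 : 0 < #|edge G| by apply/card_gt0P; exists f.
  exists (contract_edge f uv); split.
  - exact: cuts_geq_contract_edge.
  - by rewrite card_vert_contract_edge prednK.
  - by rewrite card_edge_contract_edge prednK.
  by rewrite card_edge_contract_edge (ndisc2_contract_bridge jf _ V0 S0 ST).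
case: n2; split=> // S S0 ST; rewrite ltn_neqAle eq_sym (cG.2 S) // andbT.
by have /existsPn/(_ S) := noS; rewrite S0 ST.
Qed.

Lemma ndisc2_lower (k q : nat) (G : mgraph) : 0 < k -> cuts_geq 1 G ->
  #|edge G| = #|vert G| + k ->
  q * #|edge G| <= ndisc 2 G + 3 * k * 'C(q.+1, 2).
Proof.
move=> k0; move En: #|vert G| => n; elim: n G En => [|n IH] G En cG Em.
  by have [] := cG; rewrite En.
have [/edge_connectedP-/(_ isT) c2|/edge_connectedP-/(_ isT) n2] := boolP (edge_connected 2 G).
  have [|H [l [[M] _ H0 EH dH]]] := @model_exists k G k0 c2; first by rewrite En.
  rewrite -(sum_chain_lengths M); apply: leq_trans (sum_bin2_tangent l q) _.
  by rewrite leq_add ?(sum_bin_le_ndisc M) // leq_mul2r (card_of_degree_geq3 EH) ?orbT.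
have [G' [c1 V' E' d']] := bridge_gain cG n2.
have := IH G' _ c1 _; rewrite E' => lower.
have {}lower : q * #|edge G'| <= ndisc 2 G' + 3 * k * 'C(q.+1, 2) by apply: lower; lia.
(* Contraction lowers the left side by q and the count by at least |E| - 1. If q exceeds |E| - 1 the
   bound is trivial, as q |E| <= q q <= 3k C(q + 1, 2). *)
have [le|gt] := leqP q #|edge G'|; first by rewrite mulnS; lia.
have := double_bin2 q.+1; nia.
Qed.

(** The condition q < |E| - 1 makes a bridge strictly wasteful, and q > 0 makes C(q + 1, 2)
    positive, so that fewer than 3k chains would miss the bound. *)
Lemma ndisc2_lower_eq (k q : nat) (G : mgraph) : 0 < k -> 0 < q -> cuts_geq 1 G ->
  #|edge G| = #|vert G| + k -> q < #|edge G|.-1 ->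
  ndisc 2 G + 3 * k * 'C(q.+1, 2) <= q * #|edge G| ->
  exists (D : mgraph) (l : edge D -> nat),
    [/\ in_Dk k D, inhabited (chain_model l G), balanced l & forall e, 0 < l e].
Proof.
move=> k0 q0 cG Em qm upper.
have [/edge_connectedP-/(_ isT) c2|/edge_connectedP-/(_ isT) n2] := boolP (edge_connected 2 G); last first.
  have [G' [c1 V' E' d']] := bridge_gain cG n2.
  have := @ndisc2_lower k q G' k0 c1; rewrite E' in Em upper qm *; move=> lower.
  have {}lower : q * #|edge G'| <= ndisc 2 G' + 3 * k * 'C(q.+1, 2) by apply: lower; lia.
  by rewrite mulnS in upper; lia.
have [D [l [[M] l0 D0 ED dD]]] := model_exists k0 c2 Em.
have cD := card_of_degree_geq3 ED dD.
have := sum_bin2_tangent l q; rewrite (sum_chain_lengths M) => -[tan tanE].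
have dG := sum_bin_le_ndisc M D0.
have C0 : 0 < 'C(q.+1, 2) by rewrite bin_gt0.
have cDC : #|edge D| * 'C(q.+1, 2) <= 3 * k * 'C(q.+1, 2) by rewrite leq_mul2r cD orbT.
have cD' : #|edge D| = 3 * k.
  by apply/eqP; rewrite -(eqn_pmul2r C0); lia.
have VD : #|vert D| = 2 * k by lia.
have lq : forall e, (l e == q) || (l e == q.+1).
  by apply/forallP; rewrite -tanE; rewrite cD' in tan *; lia.
exists D, l; split=> //.
  rewrite /in_Dk VD cD' !eqxx (cubic_of_card VD cD' dD) !andbT.
  apply/edge_connectedP => //; apply: (cuts_geq3_of_chain_pairs M) => //.
  - by apply/connected_cuts.
  - by rewrite cD'; lia.
  by rewrite cD' in tan; lia.
apply/forallP=> e; apply/forallP=> f.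
by have := lq e; have := lq f; lia.
Qed.

(** * Splitting vertices of large degree *)

(** For a set containing the new vertex but not v: a and b tell whether the heads of the moved darts
    lie in the set, r counts the other crossing edges, c those before the split and y the old edges
    crossing after it. The new edge crosses as well, so y > 1 suffices. *)
Lemma new_vertex_cut (a b : bool) y c r :
  y = ~~ a + (~~ b + r) -> c = a + (b + r) ->
  (a || b -> 2 < c) -> (a && b -> c != 3) -> 1 < y.
Proof.
by case: a; case: b => //= -> -> C3; rewrite ?(C3 isT) //; have := C3 isT; lia.
Qed.

Section Expand.
Variables (G : mgraph) (v : vert G) (h1 h2 : dart G).

Definition moved (e : edge G) (b : bool) : bool := ((e, b) == h1) || ((e, b) == h2).

(** In both option types [None] is new: the new edge joins v to the new vertex, which takes over the
    tails of h1 and h2 and has degree three when these lie on different edges. *)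
Definition expand : mgraph :=
  @MGraph (option (vert G)) (option (edge G))
    (fun o => if o is Some e then if moved e false then None else Some (src e)
              else Some v)
    (fun o => if o is Some e then if moved e true then None else Some (tgt e)
              else None).

Hypotheses (t1 : dtail h1 = v) (t2 : dtail h2 = v) (h12 : h1.1 != h2.1).

Lemma moved_src e : moved e false -> src e = v.
Proof. by move=> /orP[]/eqP E; [rewrite -t1 -E|rewrite -t2 -E]. Qed.

Lemma moved_tgt e : moved e true -> tgt e = v.
Proof. by move=> /orP[]/eqP E; [rewrite -t1 -E|rewrite -t2 -E]. Qed.

Definition collapse (o : vert expand) : vert G := if o is Some x then x else v.

Lemma collapse_src e : collapse (src (Some e : edge expand)) = src e.
Proof. by rewrite /=; case: ifP => // /moved_src. Qed.

Lemma collapse_tgt e : collapse (tgt (Some e : edge expand)) = tgt e.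
Proof. by rewrite /=; case: ifP => // /moved_tgt. Qed.

Lemma collapse_eq (o o' : vert expand) : collapse o = collapse o' ->
  o = o' \/ joins (None : edge expand) o o'.
Proof.
rewrite /joins; case: o o' => [x|] [y|] /= E; [left|right|right|left]; rewrite ?E ?eqxx ?orbT //.
Qed.

Lemma dart_eq (h : dart G) e b : ((e, b) == h) = (e == h.1) && (b == h.2).
Proof. by case: h. Qed.

Lemma joins_moved1 : joins (Some h1.1 : edge expand) None (Some (dhead h1)).
Proof.
rewrite /joins /dhead /= /moved !dart_eq eqxx (negPf h12) /=.
by case: h1.2; rewrite /= !eqxx ?orbT.
Qed.

Lemma joins_moved2 : joins (Some h2.1 : edge expand) None (Some (dhead h2)).
Proof.
rewrite /joins /dhead /= /moved !dart_eq eqxx [h2.1 == _]eq_sym (negPf h12) /=.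
by case: h2.2; rewrite /= !eqxx ?orbT.
Qed.

(** The only danger is a set with three crossing edges that avoids v and contains both heads: adding
    the new vertex to it removes two crossing edges and creates one. *)
Lemma cuts_geq3_expand : cuts_geq 3 G ->
  (forall S : {set vert G}, v \notin S -> dhead h1 \in S -> dhead h2 \in S -> #|cut S| != 3) ->
  cuts_geq 3 expand.
Proof.
move=> [V0 cG] notight; split; first by apply/card_gt0P; exists None.
move=> S; wlog vS : S / Some v \notin S.
  move=> IH S0 ST; have [vS|] := boolP (Some v \in S); last by move/IH; apply.
  by rewrite -cutC; apply: IH; rewrite ?inE ?negbK ?setC_eq0 ?setC_eqT.
move=> S0 ST; pose S1 := [set x | Some x \in S].
have vS1 : v \notin S1 by rewrite inE.
have S1T : S1 != setT by apply: contraNneq vS1 => ->; rewrite inE.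
have S1geq x : x \in S1 -> 3 <= #|cut S1|.
  by move=> xS; apply: cG => //; apply/set0Pn; exists x.
(* [Y] collects the old edges crossing S; the new edge crosses exactly when [None] lies in S, since
   [Some v] does not. *)
pose Y := [set e | (Some e : edge expand) \in cut S].
have YS : (None \in S) + #|Y| <= #|cut S|.
  rewrite (cardsD1 (None : edge expand)) {1}inE /= (negPf vS) /=.
  rewrite -(card_imset Y (@Some_inj _)); case: (None \in S) => /=; rewrite leq_add2l; apply: subset_leq_card;
    by apply/subsetP=> o /imsetP[e eY ->]; move: eY; rewrite !inE.
have unmoved e : e != h1.1 -> e != h2.1 -> (e \in Y) = (e \in cut S1).
  move=> e1 e2; rewrite !inE /= /moved.
  by rewrite !dart_eq (negPf e1) (negPf e2).
have [NS|NS] := boolP (None \in S); last first.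
  have [[x|] xS] := set0Pn _ S0; last by rewrite xS in NS.
  have xS1 : x \in S1 by rewrite inE.
  apply: leq_trans (S1geq x xS1) (leq_trans _ YS).
  apply/(leq_trans _ (leq_addl _ _))/subset_leq_card/subsetP=> e; rewrite !inE /=.
  case: ifP => [/moved_src->|_]; case: ifP => [/moved_tgt->|_];
    by rewrite ?(negPf NS) ?(negPf vS).
apply: leq_trans YS; rewrite NS add1n ltnS.
have Y1 : (h1.1 \in Y) = (dhead h1 \notin S1).
  by rewrite inE (in_cut_joins _ joins_moved1) NS !inE.
have Y2 : (h2.1 \in Y) = (dhead h2 \notin S1).
  by rewrite inE (in_cut_joins _ joins_moved2) NS !inE.
have C1 : (h1.1 \in cut S1) = (dhead h1 \in S1).
  rewrite inE; move: vS1; rewrite -t1 /dhead /dtail.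
  by case: (h1.2) => /negPf->; case: (_ \in _).
have C2 : (h2.1 \in cut S1) = (dhead h2 \in S1).
  rewrite inE; move: vS1; rewrite -t2 /dhead /dtail.
  by case: (h2.2) => /negPf->; case: (_ \in _).
have h21 : h2.1 \in [set~ h1.1] by rewrite !inE eq_sym.
have split_card (A : {set edge G}) :
    #|A| = (h1.1 \in A) + ((h2.1 \in A) + #|A :\ h1.1 :\ h2.1|).
  by rewrite (cardsD1 h1.1) (cardsD1 h2.1 (A :\ _)) !inE eq_sym h12.
have rest : Y :\ h1.1 :\ h2.1 = cut S1 :\ h1.1 :\ h2.1.
  apply/setP=> e; rewrite !in_setD1; have [//|e2] := eqVneq e h2.1.
  by have [//|e1] := eqVneq e h1.1; rewrite unmoved.
have cY := split_card Y; have cC := split_card (cut S1).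
rewrite rest Y1 Y2 in cY; rewrite C1 C2 in cC.
apply: (new_vertex_cut cY cC) => [/orP[]|/andP[]]; try exact: S1geq.
exact: notight.
Qed.

End Expand.

Lemma joins_dart (G : mgraph) (h : dart G) : joins h.1 (dtail h) (dhead h).
Proof. by case: h => e []; rewrite /dtail /dhead /= ?joins_src_tgt // joinsC joins_src_tgt. Qed.

Lemma card_darts (G : mgraph) (v : vert G) :
  #|[set h : edge G * bool | dtail h == v]| = degree v.
Proof.
transitivity (\sum_(e : edge G) \sum_(b : bool) (dtail ((e, b) : dart G) == v)).
  rewrite pair_bigA -sum1_card big_mkcond; apply: eq_bigr => -[e b] _.
  by rewrite inE; case: (_ == v).
rewrite /degree !card_set_sum -big_split; apply: eq_bigr => e _ /=.
by rewrite big_bool addnC.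
Qed.

(* Uncrossing: tight sets avoiding v and sharing a vertex are closed under
   union, so a maximal one through the head of h1 would capture every dart
   at v if no pair of darts could be split off. *)
Lemma exists_split (G : mgraph) (v : vert G) : cuts_geq 3 G -> 3 < degree v ->
  exists h1 h2 : dart G, [/\ dtail h1 = v, dtail h2 = v, h1.1 != h2.1 &
    forall S : {set vert G}, v \notin S -> dhead h1 \in S -> dhead h2 \in S ->
      #|cut S| != 3].
Proof.
move=> [V0 cG] dv; rewrite -card_darts in dv; set T := [set _ | _] in dv.
have /card_gt0P[h1 h1T] : 0 < #|T| by lia.
have t1 : dtail h1 = v by apply/eqP; move: h1T; rewrite inE.
pose tight (S : {set vert G}) := [&& v \notin S, dhead h1 \in S & #|cut S| == 3].
have [/existsP[h2 /and3P[/eqP t2 h12 /forallP nt]]|] := boolP [exists h2 : edge G * bool,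
    [&& dtail h2 == v, h1.1 != h2.1 & [forall S, tight S ==> (dhead h2 \notin S)]]].
  exists h1, h2; split=> // S vS h1S h2S; apply/negP=> c3.
  by have := nt S; rewrite /tight vS h1S c3 h2S.
move=> /existsPn split; exfalso.
have {}split h : h \in T -> h.1 != h1.1 -> exists2 S, tight S & dhead h \in S.
  rewrite inE => th h12; have := split h; rewrite th eq_sym h12 /=.
  by move=> /forallPn[S]; rewrite negb_imply negbK => /andP[]; exists S.
have [h2 h2T h21] : exists2 h, h \in T & h.1 != h1.1.
  have /card_gt0P[h] : 0 < #|T :\ (h1.1, true) :\ (h1.1, false)|.
    have := cardsD1 (h1.1, true) T; have := cardsD1 (h1.1, false) (T :\ (h1.1, true)).
    by do 2 case: (_ \in _); lia.
  rewrite !in_setD1 => /and3P[n1 n2 hT]; exists h => //.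
  by apply: contraNneq n1 => E; move: n2; case: h {hT} E => e [] /= ->; rewrite ?eqxx.
have [S0 S0t _] := split h2 h2T h21.
have [X Xt Xmax] := @arg_maxnP _ S0 tight (fun S => #|S|) S0t.
have /and3P[vX h1X /eqP X3] := Xt.
have headX h : h \in T -> dhead h \in X.
  (* A dart at v on the edge of h1 other than h1 would be its reverse, making v the head of h1,
     while v is outside X. *)
  move=> hT; have [E|h1h] := eqVneq h.1 h1.1.
    suff -> : h = h1 by [].
    have th : dtail h = v by apply/eqP; move: hT; rewrite inE.
    apply/eqP; apply: contraNT vX => hh1.
    suff <- : dhead h1 = v by [].
    rewrite -th; move: E hh1; case: h {hT th} h1 {h1T t1 tight split h21 h1X S0t Xt Xmax} => e b [e1 b1] /= ->.
    by rewrite xpair_eqE eqxx /dtail /dhead /=; case: b; case: b1.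
  have [S /and3P[vS h1S /eqP S3] hS] := split h hT h1h.
  have geq3 (A : {set vert G}) : v \notin A -> dhead h1 \in A -> 3 <= #|cut A|.
    move=> vA h1A; apply: cG; first by apply/set0Pn; exists (dhead h1).
    by apply: contraNneq vA => ->; rewrite inE.
  (* Union and intersection both contain the head of h1 and avoid v, so each cut has at least three
     edges, while by submodularity they sum to at most six. *)
  have tXS : tight (X :|: S).
    have := cut_submod X S; rewrite X3 S3 /tight !inE negb_or vX vS h1X /= => sub.
    have := @geq3 (X :|: S); have := @geq3 (X :&: S).
    rewrite !inE negb_or (negPf vX) vS h1X h1S => /(_ isT isT) c1 /(_ isT isT) c2.
    by rewrite eqn_leq c2 andbT; clear -c1 sub; lia.
  have := Xmax _ tXS => le; have /eqP-> : X == X :|: S by rewrite eqEcard subsetUl.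
  by rewrite inE hS orbT.
(* Two darts at v on one edge would form a loop, whose head v lies outside X. Hence more than three
   distinct edges cross X. *)
have inj : {in T &, injective (@fst (edge G) bool)}.
  move=> h h' hT h'T E; apply/eqP; apply: contraNT vX => hh'.
  suff <- : dhead h = v by exact: headX.
  have <- : dtail h' = v by apply/eqP; move: h'T; rewrite inE.
  move: E hh'; case: h {hT} h' {h'T} => e b [e1 b1] /= ->.
  by rewrite xpair_eqE eqxx /dtail /dhead /=; case: b; case: b1.
have : [set fst h | h in T] \subset cut X.
  apply/subsetP=> _ /imsetP[h hT ->]; rewrite (in_cut_joins _ (joins_dart h)) headX //.
  by have /eqP-> : dtail h == v; [move: hT; rewrite inE|rewrite (negPf vX)].
by move/subset_leq_card; rewrite card_in_imset // X3 leqNgt dv.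
Qed.

(** With fewer than 2k vertices the average degree exceeds three, so some vertex can be split. *)
Lemma exists_expansion (k : nat) (G : mgraph) : cuts_geq 3 G ->
  #|edge G| = #|vert G| + k -> #|vert G| < 2 * k ->
  exists (v : vert G) (h1 h2 : dart G), 
    [/\ dtail h1 = v, dtail h2 = v & h1.1 != h2.1] /\
    [/\ cuts_geq 3 (expand v h1 h2), #|vert (expand v h1 h2)| = #|vert G|.+1 &
    #|edge (expand v h1 h2)| = #|edge G|.+1].
Proof.
move=> cG Em Vk.
have [/existsP[v dv]|/existsPn nd] := boolP [exists v : vert G, 3 < degree v].
  have [h1 [h2 [t1 t2 h12 nt]]] := exists_split cG dv.
  exists v, h1, h2; split; split; rewrite ?card_option //.
  exact: cuts_geq3_expand.
have : 2 * #|edge G| <= #|vert G| * 3.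
  rewrite -sum_nat_const -sum_degree; apply: leq_sum => v _.
  by rewrite leqNgt nd.
by lia.
Qed.

Lemma path_darts_connect (G : mgraph) (Z : {set edge G}) (s : seq (dart G)) a b :
  path (fun a b : dart G => dhead a == dtail b) a (rcons s b) ->
  {in s, forall h, h.1 \in Z} ->
  connect (adj_del (~: Z)) (dhead a) (dtail b).
Proof.
elim: s a => [|h s IH] a /=; first by rewrite andbT => /eqP-> _; exact: connect0.
move=> /andP[/eqP-> hs] sZ; apply: connect_trans (IH h hs _); last first.
  by move=> h' h's; apply: sZ; rewrite inE h's orbT.
apply/connect1/adj_delP; exists h.1; last exact: joins_dart.
by rewrite inE negbK; apply: sZ; rewrite inE eqxx.
Qed.

(** Going round the rest of the cycle leads from the head of a back to its tail; distinctness of the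
    edges ensures that a is not reused. *)
Lemma mg_cycle_connect (G : mgraph) (Z : {set edge G}) (c : seq (dart G)) a :
  mg_cycle c -> a \in (c : seq (edge G * bool)) ->
  {in c, forall h, h.1 != a.1 -> h.1 \in Z} ->
  connect (adj_del (~: Z)) (dhead a) (dtail a).
Proof.
move=> /and4P[_ cyc _ un] ac cZ; have [i s cs] := rot_to ac.
apply: (@path_darts_connect _ Z s); first by rewrite -(rot_cycle i) cs in cyc.
move=> h hs; apply: cZ; first by rewrite -(mem_rot i) cs inE hs orbT.
rewrite -(rot_uniq i) -map_rot cs /= in un; case/andP: un => nas _.
by apply: contraNneq nas => <-; apply: map_f.
Qed.

(** * Giving the new edge of an expansion length zero *)

Section ExpandModel.
Variables (G : mgraph) (v : vert G) (h1 h2 : dart G).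
Hypotheses (t1 : dtail h1 = v) (t2 : dtail h2 = v).
Local Notation G' := (expand v h1 h2).
Variables (D : mgraph) (l' : edge D -> nat) (M : chain_model l' G').
Hypotheses (l'1 : forall e, l' e <= 1) (adm : admissible l').

Let e0 := chain M None.
Let l e := if e == e0 then 0 else l' e.

Let e0_joins : joins (None : edge G') (branch M (src e0)) (branch M (tgt e0)).
Proof.
have := pos_joins M None; rewrite -/e0.
have p0 : pos M None = 0 by have := pos_lt M None; have := l'1 e0; rewrite -/e0; lia.
have l1 : l' e0 = 1 by have := pos_lt M None; have := l'1 e0; rewrite -/e0; lia.
by rewrite p0 pt_src -pt_tgt l1.
Qed.

Let no_interior e i : ~ (0 < i < l' e).
Proof. by have := l'1 e; lia. Qed.

Let l_le e : l e <= l' e.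
Proof. by rewrite /l; case: (_ == _). Qed.

(** A cycle of weight zero must use [e0], and its other edges have [l'] zero. They would identify
    the branches of the ends of [e0], yet the new edge joins two distinct vertices. *)
Lemma expand_admissible : admissible l.
Proof.
move=> c cyc; rewrite lt0n sum_nat_seq_eq0; apply/negP => /allP c0.
have c0' h : h \in (c : seq (edge D * bool)) -> h.1 != e0 -> l' h.1 = 0.
  by move=> hc /negPf he; have := c0 h hc; rewrite /l he => /eqP.
have [/hasP[a ac /eqP ae]|/hasPn ne] := boolP (has (fun h : edge D * bool => h.1 == e0) c).
  have cZ : {in c, forall h, h.1 != a.1 -> h.1 \in [set e | l' e == 0]}.
    by move=> h hc; rewrite ae inE => /(c0' h hc)->.
  have := mg_cycle_connect cyc ac cZ; rewrite -(branch_eq M) => /eqP E.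
  have : branch M (src e0) = branch M (tgt e0).
    by move: E; rewrite -ae /dhead /dtail; case: a.2.
  have := e0_joins; rewrite /joins /= => /orP[]/andP[/eqP<- /eqP<-] //.
have := adm cyc; rewrite big1_seq ?ltnn // => h /andP[_ hc].
by apply: c0'; last exact: ne.
Qed.

Lemma expand_model : inhabited (chain_model l G).
Proof.
pose col : vert G' -> vert G := @collapse G v h1 h2.
have col_joins (e : edge G) y z : joins (Some e : edge G') y z -> joins e (col y) (col z).
  rewrite /joins => /orP[]/andP[/eqP<- /eqP<-]; rewrite /col collapse_src ?collapse_tgt //.
    by rewrite !eqxx.
  by rewrite !eqxx orbT.
have col_e0 : col (branch M (src e0)) = col (branch M (tgt e0)).
  by have := e0_joins; rewrite /joins /= => /orP[]/andP[/eqP<- /eqP<-].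
have zero_col e : l e = 0 -> col (branch M (src e)) = col (branch M (tgt e)).
  rewrite /l; have [->|_] := eqVneq e e0; first by [].
  by move=> le0; rewrite -pt_src -pt_tgt le0.
pose Z := [set e | l e == 0].
have connectW x y : connect (adj_del (~: [set e | l' e == 0])) x y -> connect (adj_del (~: Z)) x y.
  apply: connect_sub => a b /adj_delP[e eZ jab]; apply/connect1/adj_delP.
  exists e => //; move: eZ; rewrite !inE !negbK; have := l_le e; lia.
constructor.
apply: (@ChainModel D l G (fun x => col (branch M x)) (fun e i => col (pt M e i))
         (fun g => chain M (Some g)) (fun g => pos M (Some g))).
- move=> x y; apply/eqP/idP => [|cxy].
    case/collapse_eq=> [/eqP|]; first by rewrite branch_eq => /connectW.
    have ends a b : joins (None : edge G') a b ->
        (a = branch M (src e0) /\ b = branch M (tgt e0)) \/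
        (a = branch M (tgt e0) /\ b = branch M (src e0)).
      have := e0_joins; rewrite /joins /= => /orP[]/andP[/eqP<- /eqP<-] /orP[]/andP[/eqP<- /eqP<-]; by [left|right].
    have c0 : connect (adj_del (~: Z)) (src e0) (tgt e0).
      by apply/connect1/adj_delP; exists e0; rewrite ?joins_src_tgt // !inE negbK /l eqxx.
    have sym := adj_del_sym (~: Z).
    case/ends=> -[/eqP xE /eqP yE]; rewrite branch_eq in xE; rewrite branch_eq adj_del_sym in yE.
      exact: connect_trans (connectW _ _ xE) (connect_trans c0 (connectW _ _ yE)).
    rewrite sym in c0.
    exact: connect_trans (connectW _ _ xE) (connect_trans c0 (connectW _ _ yE)).
  pose A := [pred z | col (branch M z) == col (branch M x)].
  have clA : closed (adj_del (~: Z)) A.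
    move=> a b /adj_delP[e]; rewrite !inE negbK => /eqP/zero_col ze /orP[]/andP[/eqP<- /eqP<-];
      by rewrite ze.
  by have := closed_connect clA cxy; rewrite !inE eqxx => /esym/eqP->.
- by move=> e; rewrite pt_src.
- by move=> e; rewrite /l; case: eqP => [->|_]; rewrite ?pt_src ?pt_tgt.
- move=> g; rewrite /l; case: eqP => [E|_]; last exact: pos_lt.
  (* The chain of [e0] has a single edge, the new one, so no old edge lies on it. *)
  have P0 o : chain M o = e0 -> pos M o = 0.
    by move=> oE; have := pos_lt M o; have := l'1 (chain M o); lia.
  have : (Some g : edge G') = None by apply: (pos_inj (c := M)) => //; rewrite !P0.
  by [].
- by move=> g; apply: col_joins; exact: pos_joins.
- move=> g h gh ph.
  have : (Some g : edge G') = Some h by apply: (pos_inj (c := M)).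
  by case.
- move=> e i; rewrite /l; case: eqP => // /eqP ee ie.
  have [[g|] [ge gi]] := pos_surj M ie; first by exists g.
  by case/eqP: ee; rewrite -ge.
- by move=> e i f j ie; case: (@no_interior e i); have := l_le e; lia.
- by move=> e i x ie; case: (@no_interior e i); have := l_le e; lia.
move=> y; have [[x E]|[e [i [ie _]]]] := model_cover M (Some y); last by case: (no_interior ie).
by left; exists x; rewrite -E.
Qed.

End ExpandModel.

Lemma bouquet_cuts (r k : nat) : 
  cuts_geq r (@MGraph unit 'I_k (fun=> tt) (fun=> tt)).
Proof.
split=> [|S /set0Pn[[] xS] ST]; first by rewrite card_unit.
by case/eqP: ST; apply/setP=> -[]; rewrite inE.
Qed.

(** Splitting also constructs examples: start from one vertex with k + 1 loops and expand until n
    vertices are reached. The case n = 2k provides members of [in_Dk]. *)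
Lemma exists_cuts_geq3 (k n : nat) : 0 < n <= 2 * k ->
  exists G : mgraph, [/\ cuts_geq 3 G, #|vert G| = n & #|edge G| = n + k].
Proof.
case: n => // n; elim: n => [_|n IH nk].
  exists (@MGraph unit 'I_(1 + k) (fun=> tt) (fun=> tt)).
  by split; [exact: bouquet_cuts|rewrite card_unit|rewrite card_ord].
have [|G [cG Vn Em]] := IH; first by lia.
have [||v [h1 [h2 [_ [c3 V3 E3]]]]] := @exists_expansion k G cG; [lia|lia|].
by exists (expand v h1 h2); split=> //; lia.
Qed.

Lemma in_Dk_of_cuts (k : nat) (G : mgraph) : 0 < k -> cuts_geq 3 G ->
  #|vert G| = 2 * k -> #|edge G| = 3 * k -> in_Dk k G.
Proof.
move=> k0 cG VG EG; rewrite /in_Dk VG EG !eqxx !andbT; apply/andP; split.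
  exact/edge_connectedP.
apply: (cubic_of_card VG EG) => v; rewrite -cut1_degree.
apply: leq_trans (cG.2 [set v] _ _) (leq_addr _ _).
  by apply/set0Pn; exists v; rewrite inE.
by apply/negP=> /eqP E; have := cards1 v; rewrite E cardsT; lia.
Qed.

(** Expansion continues up to 2k vertices, where the graph is cubic; undoing one expansion sets one
    more length from 1 to 0. *)
Lemma contraction_of_Dk (k : nat) (G : mgraph) : 0 < k -> cuts_geq 3 G ->
  #|edge G| = #|vert G| + k -> #|vert G| <= 2 * k ->
  exists (D : mgraph) (l : edge D -> nat),
    [/\ in_Dk k D, inhabited (chain_model l G), admissible l & forall e, l e <= 1].
Proof.
move=> k0; move En: (2 * k - #|vert G|) => n; elim: n G En => [|n IH] G En cG Em Vk.
  have VG : #|vert G| = 2 * k by lia.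
  exists G, (fun=> 1); split=> //.
  - by apply: in_Dk_of_cuts => //; lia.
  - exact: identity_model.
  by move=> [|h c] // _; rewrite big_cons.
have [|v [h1 [h2 [[t1 t2 h12] [c3 V3 E3]]]]] := exists_expansion cG Em; first by lia.
have En' : 2 * k - #|vert (expand v h1 h2)| = n by lia.
have [||D [l' [DD [M] adm l1]]] := IH _ En' c3; [lia|lia|].
exists D, (fun e => if e == chain M None then 0 else l' e); split=> //.
- exact: expand_model.
- exact: expand_admissible.
by move=> e; case: (_ == _).
Qed.

(** * Extremal graphs *)

Lemma cuts_geq1_model (D G : mgraph) (l : edge D -> nat) :
  chain_model l G -> cuts_geq 1 D -> cuts_geq 1 G.
Proof.
move=> M [D0 cD]; have V0 : 0 < #|vert G|.
  by case/card_gt0P: D0 => x0 _; apply/card_gt0P; exists (branch M x0).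
split=> // S S0 ST; rewrite card_gt0; apply/negP=> /eqP c0.
have same e i : i <= l e -> (pt M e i \in S) = (branch M (src e) \in S).
  move=> ie; apply/eqP; rewrite -pt_src eq_sym; apply/negPn/negP.
  by case/(chain_crossing (leq0n _) ie) => g []; rewrite c0 inE.
pose S1 := [set x | branch M x \in S].
have c1 : #|cut S1| = 0.
  apply/eqP; rewrite cards_eq0; apply/eqP/setP=> e.
  by rewrite !inE -pt_tgt same // eqxx.
have [x0 x0S] : exists x, branch M x \in S.
  case/set0Pn: S0 => y yS; have [[x E]|[e [i [ie E]]]] := model_cover M y.
    by exists x; rewrite -E.
  by exists (src e); rewrite -(same e i) -?E //; lia.
have S1T : S1 = setT.
  apply/eqP; apply/negPn/negP => /cD; rewrite c1 => /(_ _)/notF; apply.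
  by apply/set0Pn; exists x0; rewrite inE.
case/eqP: ST; apply/setP=> y; rewrite in_setT.
have inS1 x : branch M x \in S by have /setP/(_ x) := S1T; rewrite !inE.
have [[x ->]|[e [i [ie ->]]]] := model_cover M y.
  exact: inS1.
by rewrite same ?inS1 //; lia.
Qed.

(** Nothing is contracted, and a chain of length l adds l - 1 vertices; the additive form avoids
    truncated subtraction. *)
Lemma card_vert_weak_subdivide (D : mgraph) (l : edge D -> nat) :
  (forall e, 0 < l e) ->
  #|vert (weak_subdivide l)| + #|edge D| = #|vert D| + \sum_e l e.
Proof.
move=> l0; pose Z := [set e | l e == 0].
have [M] := weak_subdivide_model l.
have Z0 : Z = set0 by apply/setP=> e; rewrite !inE -[_ == _]negbK -lt0n l0.
have card_chains (T : finType) (F : T -> nat) : #|{: {x : T & 'I_(F x)}}| = \sum_x F x.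
  rewrite card_tagged sumnE big_map big_enum /=.
  by apply: eq_bigr => x _; rewrite card_ord.
have cV : #|contract_vert Z| = #|vert D|.
  symmetry; apply: (@bij_eq_card _ _ (@contract_proj D Z)).
  exists (@contract_repr D l) => [x|A]; last exact: contract_reprK.
  apply/eqP; rewrite -in_set1 (connect_cut (y := x) (F := ~: Z) (S := [set x])) ?inE //.
    by rewrite -contract_proj_eq contract_reprK.
  by rewrite Z0 setC0 subsetT.
have cE : #|edge (contract Z)| = #|edge D|.
  by rewrite card_sig; apply: eq_card => e; rewrite Z0 !inE.
have pred_sum : \sum_(e : edge (contract Z)) (l (val e)).-1 + #|edge D| = \sum_e l e.
  rewrite (sum_chain_lengths M) card_chains -cE -sum1_card -big_split.
  by apply: eq_bigr => e _ /=; rewrite addn1 prednK.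
rewrite -pred_sum addnA -cV -card_chains; congr (_ + _); exact: card_sum.
Qed.

Lemma ndisc2_cuts_geq3 (G : mgraph) : cuts_geq 3 G -> ndisc 2 G = 0.
Proof.
move=> /(@edge_connectedP 3)-/(_ isT)/forallP ec; apply/eqP; rewrite cards_eq0.
apply/eqP/setP=> F; rewrite !inE; apply/negP=> /andP[/eqP F2].
by have := ec F; rewrite F2 /= => ->.
Qed.

Lemma admissible_gt0 (D : mgraph) (l : edge D -> nat) :
  (forall e, 0 < l e) -> admissible l.
Proof. by move=> l0 [|h c] // _; rewrite big_cons ltn_addr. Qed.

Lemma in_Dk_cuts (k : nat) (D : mgraph) : in_Dk k D ->
  cuts_geq 3 D /\ #|edge D| = 3 * k.
Proof. by case/and4P=> /edge_connectedP-/(_ isT) cD _ _ /eqP. Qed.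

(** One zero length bounds all others by 1, so the total falls below the number of chains. *)
Lemma balanced_gt0 (D : mgraph) (l : edge D -> nat) :
  balanced l -> #|edge D| <= \sum_e l e -> forall e, 0 < l e.
Proof.
move=> bl le e; rewrite lt0n; apply/negP=> /eqP e0; move: le.
rewrite leqNgt => /negP; apply.
rewrite (bigD1 e) //= e0 -[#|edge D|]sum1_card [X in _ < X](bigD1 e) //= ltnS.
by apply: leq_sum => f _; have /forallP/(_ f)/forallP/(_ e) := bl; rewrite e0.
Qed.

Lemma balanced_dichotomy (D : mgraph) (l : edge D -> nat) : 0 < #|edge D| ->
  balanced l -> exists q, [forall e, (l e == q) || (l e == q.+1)].
Proof.
case/card_gt0P=> e0 _ bl; have [e _ emin] := @arg_minnP _ e0 predT l isT.
exists (l e); apply/forallP=> f.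
by have := emin f isT; have /forallP/(_ f)/forallP/(_ e) := bl; lia.
Qed.

(** The equality case of the lower bound applies to a minimizer only once some graph is known to
    reach the bound. *)
Lemma exists_attaining (k n : nat) : 0 < k -> 2 * k <= n ->
  exists H : mgraph, [/\ cuts_geq 1 H, #|vert H| = n, #|edge H| = n + k &
    ndisc 2 H + 3 * k * 'C(((n + k) %/ (3 * k)).+1, 2) =
      (n + k) %/ (3 * k) * (n + k)].
Proof.
move=> k0 kn; have [|D [cD VD ED]] := @exists_cuts_geq3 k (2 * k); first by lia.
set q := _ %/ _; pose r := (n + k) %% (3 * k).
have q0 : 0 < q by rewrite divn_gt0; lia.
(* The remainder r counts the chains of length q + 1; the others have length q. *)
have [||A _ cA] := @exists_superset_card (edge D) set0 r; first by rewrite cards0.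
  by rewrite ED ltnW // (leq_trans (ltn_pmod _ _)) //; lia.
pose l (e : edge D) := q + (e \in A).
have l0 e : 0 < l e by rewrite ltn_addr.
have sum_l : \sum_e l e = n + k.
  rewrite big_split /= sum_nat_const [RHS](divn_eq (n + k) (3 * k)) -/q -/r -cA.
  congr (_ + _); first by rewrite mulnC; congr (_ * _); rewrite -[LHS]/#|edge D| ED; lia.
  by rewrite -sum1_card [RHS]big_mkcond; apply: eq_bigr => e _; case: (e \in A).
have [M] := weak_subdivide_model l.
exists (weak_subdivide l); split.
- exact: cuts_geq1_model M (cuts_geqW _ cD).
- by have := card_vert_weak_subdivide l0; rewrite sum_l VD ED; lia.
- by rewrite -(sum_chain_lengths M).
have [_ tanE] := sum_bin2_tangent l q.
rewrite (ndisc2_model M cD) -sum_l; apply/esym/eqP.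
have -> : 3 * k = #|edge D| by rewrite ED; lia.
rewrite tanE; apply/forallP=> e; rewrite /l.
by case: (e \in A); rewrite ?addn0 ?addn1 eqxx ?orbT.
Qed.

Lemma in_GnmP (n m : nat) (G : mgraph) :
  in_Gnm n m G <-> [/\ cuts_geq 1 G, #|vert G| = n & #|edge G| = m].
Proof.
split=> [/and3P[cG /eqP V /eqP E]|[cG V E]]; first by split=> //; exact/connected_cuts.
by rewrite /in_Gnm V E !eqxx andbT; apply/andP; split=> //; exact/connected_cuts.
Qed.

Lemma balanced_minimizes (k n : nat) (G D : mgraph) (l : edge D -> nat) :
  0 < k -> in_Gnm n (n + k) G -> in_Dk k D -> weak_subdivision l G -> balanced l ->
  minimizes_ndisc 2 n (n + k) G.
Proof.
move=> k0 Gnm DD [_ /model_of_mg_iso[M]] bl; split=> // H /in_GnmP[cH VH EH].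
have [_ _ EG] := iffLR (in_GnmP _ _ _) Gnm.
have [cD ED] := in_Dk_cuts DD.
have [|q lq] := balanced_dichotomy _ bl; first by rewrite ED; lia.
have [_ ] := sum_bin2_tangent l q; rewrite lq (sum_chain_lengths M) -(ndisc2_model M cD).
have := @ndisc2_lower k q H k0 cH; rewrite EH EG VH ED => /(_ erefl) lower /eqP tan.
by rewrite -(leq_add2r (3 * k * 'C(q.+1, 2))) -tan.
Qed.

Lemma minimizer_balanced (k n : nat) (G : mgraph) :
  0 < k -> 0 < n -> minimizes_ndisc 2 n (n + k) G ->
  exists (D : mgraph) (l : edge D -> nat),
    [/\ in_Dk k D, weak_subdivision l G & balanced l].
Proof.
move=> k0 n0 [/in_GnmP[cG VG EG] minG].
have [kn|kn] := leqP n (2 * k).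
  have [|H [cH VH EH]] := @exists_cuts_geq3 k n; first by rewrite n0.
  have dG : ndisc 2 G = 0.
    have : ndisc 2 G <= ndisc 2 H.
      by apply: minG; apply/in_GnmP; split=> //; exact: cuts_geqW cH.
    by rewrite (ndisc2_cuts_geq3 cH) leqn0 => /eqP.
  have c3 : cuts_geq 3 G.
    by apply: ndisc2_eq0 => //; [exact/connected_cuts|rewrite EG; lia].
  have [||D [l [DD [M] adm l1]]] := contraction_of_Dk k0 c3; rewrite ?VG //.
  exists D, l; split=> //; first by split=> //; exact: mg_iso_of_model M.
  by apply/forallP=> e; apply/forallP=> f; rewrite (leq_trans (l1 e)).
have [H [cH VH EH dH]] := exists_attaining k0 (ltnW kn).
have le : ndisc 2 G <= ndisc 2 H by apply: minG; apply/in_GnmP.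
set q := (n + k) %/ (3 * k) in dH.
have q0 : 0 < q by rewrite divn_gt0; lia.
(* With m = n + k, q is at most m / 3, which is below m - 1 because m >= 4. *)
have qm : q < (n + k).-1.
  have : q <= (n + k) %/ 3 by rewrite leq_div2l //; lia.
  have := leq_divM (n + k) 3; lia.
have [|||D [l [DD [M] bl l0]]] := @ndisc2_lower_eq k q G k0 q0 cG; rewrite ?EG ?VG //.
  by rewrite -dH leq_add2r.
exists D, l; split=> //; split; [exact: admissible_gt0|exact: mg_iso_of_model M].
Qed.

(** The longer chain loses l e - 1 pairs and the shorter gains l f, which is smaller. *)
Lemma sum_move_edge (D : mgraph) (l : edge D -> nat) (e f : edge D) :
  l f + 2 <= l e ->
  \sum_g 'C(move_edge l e f g, 2) < \sum_g 'C(l g, 2).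
Proof.
move=> lfe; have fe : f != e by apply/eqP=> E; rewrite E in lfe; lia.
rewrite (bigD1 e) //= (bigD1 f) //= [ltnRHS](bigD1 e) //= [X in _ < _ + X](bigD1 f) //=.
rewrite !addnA (eq_bigr (fun g => 'C(l g, 2))) => [|g /andP[ge gf]]; last first.
  by rewrite /move_edge (negPf ge) (negPf gf).
rewrite ltn_add2r /move_edge !eqxx (negPf fe).
case: (l e) lfe => [|m]; first by lia.
by rewrite /= !binS !bin1; lia.
Qed.

(** Only the weight of e decreases, and it stays positive; a cycle of weight zero afterwards would
    have had weight zero before. *)
Lemma admissible_move_edge (D : mgraph) (l : edge D -> nat) (e f : edge D) :
  admissible l -> 1 < l e -> admissible (move_edge l e f).
Proof.
move=> adm le c cyc; have := adm c cyc; rewrite !lt0n; apply: contra.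
rewrite !sum_nat_seq_eq0 => /allP c0; apply/allP=> h hc.
have := c0 h hc; rewrite /move_edge /=.
by have [->|_] := eqVneq h.1 e; [lia|case: ifP].
Qed.

Theorem theorem6p1 (k n : nat) (hk : 1 <= k) (hn : 1 <= n) :
  (forall G : mgraph, in_Gnm n (n + k) G ->
     (minimizes_ndisc 2 n (n + k) G <->
      exists (D : mgraph) (l : edge D -> nat),
        [/\ in_Dk k D, weak_subdivision l G & balanced l]) /\
     (2 * k <= n ->
      (minimizes_ndisc 2 n (n + k) G <->
       exists (D : mgraph) (l : edge D -> nat),
         [/\ in_Dk k D, weak_subdivision l G, balanced l
           & forall e : edge D, 0 < l e]))) /\
  (forall (D : mgraph) (l : edge D -> nat) (G : mgraph),
     in_Dk k D -> weak_subdivision l G -> ~~ balanced l ->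
     forall e f : edge D, l f + 2 <= l e ->
       admissible (move_edge l e f) /\
       (forall G' : mgraph, weak_subdivision (move_edge l e f) G' ->
          ndisc 2 G' < ndisc 2 G)).
Proof.
split=> [G Gnm|D l G DD [adm /model_of_mg_iso[M]] _ e f lfe].
  have onlyif := @minimizer_balanced k n G hk hn.
  split=> [|kn]; split=> //.
  - by move=> [D [l [DD wG bl]]]; exact: balanced_minimizes DD wG bl.
  - move=> /onlyif[D [l [DD wG bl]]]; exists D, l; split=> //.
    (* For n >= 2k the total length n + k reaches the number 3k of chains. *)
    apply: balanced_gt0 bl _; have [_ ->] := in_Dk_cuts DD.
    case: wG => _ /model_of_mg_iso[M]; rewrite (sum_chain_lengths M).
    by have [_ _ ->] := iffLR (in_GnmP _ _ _) Gnm; lia.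
  by move=> [D [l [DD wG bl _]]]; exact: balanced_minimizes DD wG bl.
split; first by apply: admissible_move_edge adm _; lia.
move=> G' [_ /model_of_mg_iso[M']]; have [cD _] := in_Dk_cuts DD.
by rewrite (ndisc2_model M cD) (ndisc2_model M' cD) sum_move_edge.
Qed.
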